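(* Let $f$ and $g$ be positive strongly hereditary polynomials with $f\sim g$, and suppose $\mathscr{K}_f$ and $\mathscr{K}_g$ are nonempty. Then $f$ is hereditary Lorentzian if and only if $g$ is hereditary Lorentzian.
   Context: Notation: $D_\mathbf{u}=\sum u_i\partial_i$, $\partial^T=\prod_{i\in T}\partial_i$; $L_f=\{\mathbf{v}:D_\mathbf{v}f\equiv0\}$; $\Delta_f=\{T:\partial^Tf\not\equiv0\}$; $\tau\Delta$ is $\Delta$ with facets removed; $V_T$ is the vertex set of $\mathrm{lk}_\Delta(T)=\{R:R\cap T=\varnothing,R\cup T\in\Delta\}$. $(\Delta,L)$ is hereditary if for every $T\in\Delta$, $\ell\mapsto(\ell_i)_{i\in T}$ maps $L$ onto $\mathbb{R}^T$. A homogeneous $f$ is hereditary if $(\tau\Delta_f,L_f)$ is hereditary and strongly hereditary if $(\Delta_f,L_f)$ is; it is positive if $\partial^Ff>0$ for every facet $F$ of $\Delta_f$. Stellar subdivision operator: for $f\in\mathbb{R}[t_i:i\in V]$ strongly hereditary, $S\in\Delta_f$ with $s=|S|\ge1$, positive reals $\mathbf{c}=(c_i)_{i\in S}$, and a new variable $t_0$, $\mathrm{sub}^\mathbf{c}_S(f)=f-(-1)^s\sum_{n\ge s}\frac{z^n}{n!}h_{n-s}(\bar\partial)\bar\partial^Sf$, with $\bar\partial_i=\partial_i/c_i$, $\bar\partial^S=\prod_{i\in S}\bar\partial_i$, $h_k$ the complete homogeneous symmetric polynomial of degree $k$ in the $\bar\partial_i$ ($i\in S$), and $z=t_0-\sum_{i\in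 S}c_it_i$. The relation $f\sim g$ means there is a finite sequence $f=f_0,f_1,\dots,f_m=g$ of strongly hereditary polynomials such that for each $k$, either $f_k=\mathrm{sub}^\mathbf{c}_S(f_{k-1})$ with $S\in\Delta_{f_{k-1}}$ or $f_{k-1}=\mathrm{sub}^\mathbf{c}_S(f_k)$ with $S\in\Delta_{f_k}$, for some positive $\mathbf{c}$ (new variables being added accordingly). $f^T=\partial^Tf|_{t_i=0,i\in T}$. For $T\in\tau\Delta_f$, $\pi_T(\mathbf{x})=(\mathbf{x}-\sum_{i\in T}x_i\ell^{(i)})|_{V_T}$ with $\ell^{(i)}\in L_f$, $\ell^{(i)}_i=1$, $\ell^{(i)}_j=0$ for $j\in T\setminus\{i\}$. $\mathscr{K}_f$: if $\deg f=1$, $\{\mathbf{v}:f(\mathbf{v})>0\}$; else $(\mathbb{R}^V_{>0}+L_f)\cap\{\mathbf{v}:\pi_{\{i\}}(\mathbf{v})\in\mathscr{K}_{f^{\{i\}}}$ for all vertices $i$ of $\Delta_f\}$. For an open convex cone $\mathscr{K}$, a degree-$m\ge1$ homogeneous $h$ is $\mathscr{K}$-Lorentzian if for all $\mathbf{v}_1,\dots,\mathbf{v}_m\in\mathscr{K}$, $D_{\mathbf{v}_1}\cdots D_{\mathbf{v}_m}h>0$ and (if $m\ge2$) $(\mathbf{x},\mathbf{y})\mapsto D_\mathbf{x}D_\mathbf{y}D_{\mathbf{v}_3}\cdots D_{\mathbf{v}_m}h$ has exactly one positive eigenvalue; nonnegative constants are $\mathscr{K}$-Lorentzian. $f$ is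 hereditary Lorentzian if $f^T$ is $\mathscr{K}_{f^T}$-Lorentzian for all $T\in\tau\Delta_f$. *)

(* Defs.v *)
From HB Require Import structures.
From mathcomp Require Import all_boot all_order all_algebra.
From mathcomp Require Import reals.
From mathcomp Require Import mpoly.

Set Implicit Arguments.
Unset Strict Implicit.
Unset Printing Implicit Defensive.

Import Order.TTheory GRing.Theory Num.Theory.
Local Open Scope ring_scope.

(* All polynomials live in one ring {mpoly R[N]}, and the ring R[t_i : i in V]
   of a finite variable set V : {set 'I_N} is the subring cut out by [poly_in].
   A vector of R^V is a row vector whose coordinates outside V vanish.  Since a
   chain of subdivisions uses finitely many variables altogether, quantifying
   over all N loses nothing. *)

Section Complexes.
Variable N : nat.
Implicit Types (D : {set {set 'I_N}}) (T F : {set 'I_N}).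

Definition facet D F := maxset (fun T => T \in D) F.

Definition tau D := [set T in D | ~~ facet D T].

Definition link D T := [set U in powerset (~: T) | U :|: T \in D].

Definition vertices D := [set i | [set i] \in D].

End Complexes.

Section Polynomials.
Variables (R : realType) (N : nat).
Implicit Types (V W S T F : {set 'I_N}) (f g h : {mpoly R[N]}).
Implicit Types (u v x : 'rV[R]_N).

Definition poly_in V f :=
  forall m, m \in msupp f -> forall i, i \notin V -> m i = 0%N.

Definition vec_in V v := forall i, i \notin V -> v 0 i = 0.

Definition restrict V v : 'rV[R]_N := \row_i (if i \in V then v 0 i else 0).

(* The zero polynomial gets degree 0. *)
Definition degree f := (msize f).-1.

Definition homogeneous f := exists d, f \is d.-homog.

Definition Ddir u f : {mpoly R[N]} := \sum_i u 0 i *: f^`M(i).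

Definition Ddirs (vs : seq 'rV[R]_N) f := foldr Ddir f vs.

Definition dpart T f : {mpoly R[N]} := f^`M[mesym1 T].

Definition lineality V f v := vec_in V v /\ Ddir v f = 0.

Definition Delta f := [set T | dpart T f != 0].

Definition hereditary_pair (D : {set {set 'I_N}}) (L : 'rV[R]_N -> Prop) :=
  forall T, T \in D -> forall a : 'I_N -> R,
    exists2 l, L l & forall i, i \in T -> l 0 i = a i.

Definition strongly_hereditary V f :=
  [/\ poly_in V f, homogeneous f & hereditary_pair (Delta f) (lineality V f)].

Definition pos_const f := exists2 a : R, 0 < a & f = a%:MP.

Definition positive f := forall F, facet (Delta f) F -> pos_const (dpart F f).

(* f^T, a polynomial in the variables [linkV f T] *)
Definition contract f T : {mpoly R[N]} :=
  dpart T f \mPo [tuple (if i \in T then 0 else 'X_i) | i < N].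

Definition linkV f T := vertices (link (Delta f) T).

(* h_k evaluated at the operators \partial_i / c_i, i \in S *)
Definition hpart (c : 'I_N -> R) S k f : {mpoly R[N]} :=
  \sum_(m : 'X_{1..N < k.+1} | (mdeg m == k) && [forall i, (i \notin S) ==> (m i == 0%N)])
    (\prod_(i in S) (c i) ^- m i) *: f^`M[m].

(* The sum over n stops at the degree of f: the later terms vanish. *)
Definition subdivision (t0 : 'I_N) (c : 'I_N -> R) S f : {mpoly R[N]} :=
  let z := 'X_t0 - \sum_(i in S) c i *: 'X_i in
  f - (-1) ^+ #|S| *
      \sum_(#|S| <= n < (degree f).+1)
        (n`!%:R^-1 *: z ^+ n) *
        hpart c S (n - #|S|) ((\prod_(i in S) (c i)^-1) *: dpart S f).

Definition sub_step f g :=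
  exists V t0 S (c : 'I_N -> R),
    [/\ poly_in V f /\ t0 \notin V, S \in Delta f, (0 < #|S|)%N,
        (forall i, i \in S -> 0 < c i) & g = subdivision t0 c S f].

Definition sub_equiv f g :=
  exists (m : nat) (F : nat -> {mpoly R[N]}),
    [/\ F 0%N = f, F m = g,
        (forall k, (k <= m)%N -> exists V, strongly_hereditary V (F k)) &
        (forall k, (k < m)%N -> sub_step (F k) (F k.+1) \/ sub_step (F k.+1) (F k))].

(* The vectors l^(i), i \in T, entering \pi_T. *)
Definition proj_family V f T (l : 'I_N -> 'rV[R]_N) :=
  forall i, i \in T ->
    lineality V f (l i) /\ forall j, j \in T -> l i 0 j = (j == i)%:R.

Definition proj f T (l : 'I_N -> 'rV[R]_N) x : 'rV[R]_N :=
  restrict (linkV f T) (x - \sum_(i in T) x 0 i *: l i).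

(* The cone K_f in R^V.  Its recursion goes down in the degree of f, so it is
   the least solution of the defining clauses.  \pi_{i} is determined by f only
   up to the lineality space of f^{i}, under which the cone of f^{i} is
   invariant; hence any choice of l^(i) gives the same condition. *)
Inductive cone : {set 'I_N} -> {mpoly R[N]} -> 'rV[R]_N -> Prop :=
| cone_linear V f v of degree f = 1%N & vec_in V v & 0 < f.@[v 0] : cone V f v
| cone_rec V f v p l of
    degree f <> 1%N &
    vec_in V p & (forall i, i \in V -> 0 < p 0 i) &
    lineality V f l & v = p + l &
    (forall i, i \in vertices (Delta f) ->
       forall e, proj_family V f [set i] e ->
         cone (linkV f [set i]) (contract f [set i]) (proj f [set i] e v)) :
    cone V f v.

(* Matrix of (x, y) |-> D_x D_y h for h of degree 2.  Rows and columns of the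
   variables not occurring in h are zero, so they only add eigenvalues 0 to the
   form on R^V. *)
Definition form_mx h : 'M[R]_N := \matrix_(i, j) (h^`M(i)^`M(j))@_0%MM.

(* Counted with multiplicity; A is symmetric here, so the dimension of an
   eigenspace is the multiplicity of the eigenvalue. *)
Definition one_pos_eigenvalue (A : 'M[R]_N) :=
  exists a, [/\ 0 < a, \rank (eigenspace A a) = 1%N &
                forall b, 0 < b -> eigenvalue A b -> b = a].

Definition lorentzian (K : 'rV[R]_N -> Prop) h :=
  [/\ h \is (degree h).-homog,
      degree h = 0%N -> 0 <= h@_0%MM &
      (0 < degree h)%N ->
      forall vs : (degree h).-tuple 'rV[R]_N, (forall i, K (tnth vs i)) ->
        pos_const (Ddirs vs h) /\
        ((1 < degree h)%N ->
           one_pos_eigenvalue (form_mx (Ddirs (drop 2 vs) h)))].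

Definition hereditary_lorentzian f :=
  forall T, T \in tau (Delta f) ->
    lorentzian (cone (linkV f T) (contract f T)) (contract f T).

End Polynomials.

(* Main.v *)
(* The hereditary Lorentzian property is local.  For a positive strongly
   hereditary f of degree d with nonempty cone it is equivalent to: the star of
   every face of Delta_f is strongly connected, and every quadratic derivative
   \partial^T f, |T| = d - 2, has at most one positive eigenvalue.

   From local to global, one inducts on the degree.  If v = p + l lies in the
   cone, p > 0 and l in the lineality space, the Hessian H of
   D_v D_{v_4} ... D_{v_d} f has nonnegative off-diagonal entries and p is a
   positive eigenvector, with eigenvalue 1, of E^-1 H, where E is diagonal with
   entries (Hp)_i / p_i.  The reversed Cauchy-Schwarz inequalities for the
   derivatives \partial_i f, known by induction, say that every eigenvalue a
   satisfies a^2 >= a, and by Perron-Frobenius 1 is the largest eigenvalue and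
   is simple: all the others are <= 0.

   The local condition does not involve cones, so it can be followed along a
   chain whose intermediate cones may be empty.  A quadratic derivative of
   sub_S(f) is, up to a positive factor, a quadratic derivative of f after a
   linear change of variables, a product of two linear forms, the square of a
   linear form, or a quadratic derivative of f minus a multiple of z^2;
   conversely the quadratic derivatives of f are restrictions to z = 0 of those
   of sub_S(f). *)
Require Import Defs.
From HB Require Import structures.
From mathcomp Require Import all_boot all_order all_algebra.
From mathcomp Require Import reals mpoly.
From mathcomp Require Import ring lra zify.

Set Implicit Arguments.
Unset Strict Implicit.
Unset Printing Implicit Defensive.

Import Order.TTheory GRing.Theory Num.Theory.
Local Open Scope ring_scope.

(** * Quadratic forms with at most one positive eigenvalue *)

(** The eigenvalue condition is carried as an inequality q <= c l^2 with l linear. In this form it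
    passes at once through linear substitutions, nonnegative factors and decreases of q, which is
    what a subdivision does to quadratic derivatives, and it holds for the zero form, which is what
    a non-face contributes. Existence of a positive eigenvalue is supplied separately, by positivity
    on the cone.

    Nothing is assumed about the signs of the facet coefficients of the intermediate polynomials,
    while subtracting a multiple of z^2 is harmless only when the multiple is nonnegative;
    nonnegativity of these coefficients is therefore transported together with the rest.

    The bound a^2 >= a comes from H = sum p_i H_i, with H_i the form belonging to \partial_i f.
    Since H_i(v,x) = (Hx)_i and H_i(v,v) = (Hp)_i = E_i p_i, reversed Cauchy-Schwarz reads H_i(x,x)
    <= (Hx)_i^2 / (E_i p_i); for Hx = a E x, summation against p gives a S <= a^2 S with S = sum E_i
    x_i^2 > 0. *)

Section Forms.
Variables (R : realType) (N : nat).
Implicit Types (A B : 'M[R]_N) (x y w u : 'rV[R]_N).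

Definition bil A x y : R := (x *m A *m y^T) 0 0.

Definition is_lin (l : 'rV[R]_N -> R) :=
  forall a x y, l (a *: x + y) = a * l x + l y.

(* For a quadratic form q: at most one positive eigenvalue, with multiplicity. *)
Definition hyperbolic (q : 'rV[R]_N -> R) :=
  exists c l, [/\ 0 <= c, is_lin l & forall x, q x <= c * l x ^+ 2].

Lemma bilE A x y : bil A x y = \sum_i (x *m A) 0 i * y 0 i.
Proof. by rewrite /bil mxE; apply: eq_bigr => i _; rewrite [_^T _ _]mxE. Qed.

Lemma bilEE A x y : bil A x y = \sum_i \sum_j x 0 j * A j i * y 0 i.
Proof.
by rewrite bilE; apply: eq_bigr => i _; rewrite mxE mulr_suml.
Qed.

Lemma bilDl A x y w : bil A (x + y) w = bil A x w + bil A y w.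
Proof. by rewrite /bil !mulmxDl mxE. Qed.

Lemma bilZl A a x w : bil A (a *: x) w = a * bil A x w.
Proof. by rewrite /bil -!scalemxAl mxE. Qed.

Lemma bilDr A x y w : bil A w (x + y) = bil A w x + bil A w y.
Proof. by rewrite /bil linearD /= mulmxDr mxE. Qed.

Lemma bilZr A a x w : bil A w (a *: x) = a * bil A w x.
Proof. by rewrite /bil linearZ /= -scalemxAr mxE. Qed.

Lemma bilC A x y : A^T = A -> bil A x y = bil A y x.
Proof.
move=> sA; rewrite /bil -[in LHS](trmxK (x *m A *m y^T)) [in LHS]mxE.
by rewrite !trmx_mul trmxK sA mulmxA.
Qed.

Lemma bil_sqr A x y t : A^T = A ->
  bil A (x + t *: y) (x + t *: y) =
  bil A x x + t * bil A x y *+ 2 + t ^+ 2 * bil A y y.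
Proof.
move=> sA; rewrite bilDl !bilDr !bilZl !bilZr (bilC y x sA).
by rewrite -addrA mulr2n expr2 -mulrA !addrA.
Qed.

Lemma is_linZ l a x : is_lin l -> l (a *: x) = a * l x.
Proof.
move=> hl; have h0 : l 0 = 0.
  have := hl 1 0 0; rewrite scaler0 addr0 mul1r => h.
  by apply: (addrI (l 0)); rewrite addr0 -h.
by rewrite -[a *: x]addr0 hl h0 addr0.
Qed.

Lemma is_linD l x y : is_lin l -> l (x + y) = l x + l y.
Proof. by move=> hl; have := hl 1 x y; rewrite scale1r mul1r. Qed.

(** Moving [x] along [w] into the kernel of [l] makes the form nonpositive there, and by
    orthogonality the move only adds [t ^+ 2 * bil A w w], which is nonnegative. *)
Lemma hyperbolic_orth A w x : A^T = A -> hyperbolic (fun x => bil A x x) ->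
  0 < bil A w w -> bil A w x = 0 -> bil A x x <= 0.
Proof.
move=> sA [c [l [c0 hl hA]]] w0 wx.
have lw : l w != 0.
  apply/eqP => lw; have := hA w; rewrite lw expr0n mulr0 leNgt.
  by rewrite w0.
pose t := - l x / l w.
have := hA (x + t *: w); rewrite bil_sqr // (bilC x w sA) wx mulr0 mul0rn addr0.
rewrite is_linD // is_linZ // divfK // subrr expr0n mulr0.
apply: le_trans; rewrite lerDl; apply: mulr_ge0; [exact: sqr_ge0|exact: ltW].
Qed.

(** This is [hyperbolic_orth] for the component of [x] orthogonal to [w]. *)
Lemma hyperbolic_CS A w x : A^T = A -> hyperbolic (fun x => bil A x x) ->
  0 < bil A w w -> bil A w w * bil A x x <= bil A w x ^+ 2.
Proof.
move=> sA hA w0; pose t := - bil A w x / bil A w w.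
have w1 : bil A w w != 0 by rewrite gt_eqF.
have := @hyperbolic_orth A w (x + t *: w) sA hA w0.
rewrite bilDr bilZr divfK // subrr => /(_ erefl).
rewrite bil_sqr // (bilC x w sA) => h.
have := ler_wpM2l (ltW w0) h; rewrite mulr0 => {}h.
suff -> : bil A w w * bil A x x =
  bil A w w * (bil A x x + t * bil A w x *+ 2 + t ^+ 2 * bil A w w) + bil A w x ^+ 2.
  by rewrite gerDr.
by rewrite /t; field.
Qed.

(** Each square is at most the weighted norm divided by [d i], and products are bounded by sums of
    squares. The bound takes the place of compactness of the unit sphere when Rayleigh quotients are
    maximised; the summand 1 keeps [C] positive for A = 0. *)
Lemma bil_bounded (d : 'I_N -> R) A : (forall i, 0 < d i) ->
  exists2 C, 0 < C & forall x, bil A x x <= C * \sum_i d i * x 0 i ^+ 2.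
Proof.
move=> d0; exists (1 + \sum_i \sum_j `|A j i| * ((d i)^-1 + (d j)^-1)).
  apply: ltr_pwDl => //; apply: sumr_ge0 => i _; apply: sumr_ge0 => j _.
  by rewrite mulr_ge0 // addr_ge0 // invr_ge0 ltW.
move=> x; set n := \sum_i d i * _.
have n0 : 0 <= n by apply: sumr_ge0 => i _; rewrite mulr_ge0 ?sqr_ge0 ?ltW.
have xn i : x 0 i ^+ 2 <= (d i)^-1 * n.
  rewrite ler_pdivlMl // /n (bigD1 i) //= lerDl; apply: sumr_ge0 => j _.
  by rewrite mulr_ge0 ?sqr_ge0 ?ltW.
rewrite mulrDl mul1r bilEE -[leLHS]add0r; apply: lerD => //.
rewrite mulr_suml; apply: ler_sum => i _; rewrite mulr_suml; apply: ler_sum => j _.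
apply: le_trans (ler_norm _) _; rewrite !normrM mulrAC mulrC -mulrA.
apply: ler_wpM2l => //; rewrite mulrDl.
apply: le_trans (lerD (xn i) (xn j)).
rewrite -[x 0 i ^+ 2]real_normK ?num_real // -[x 0 j ^+ 2]real_normK ?num_real //.
have := sqr_ge0 (`|x 0 i| - `|x 0 j|); rewrite sqrrB.
have : 0 <= `|x 0 i| * `|x 0 j| by rewrite mulr_ge0.
set a := `|_|; set b := `|_|; nra.
Qed.

(* The maximum of the Rayleigh quotient is an eigenvalue: otherwise
   [a *: D - A] is invertible and psd, hence bounded below by a multiple
   of [D], so [a] could be decreased. *)
Lemma pencil_top A (d : 'I_N -> R) x0 :
  A^T = A -> (forall i, 0 < d i) -> 0 < bil A x0 x0 ->
  exists a u, [/\ 0 < a, u != 0 & forall i, (u *m A) 0 i = a * d i * u 0 i].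
Proof.
move=> sA d0 Ax0; pose nd x := \sum_i d i * x 0 i ^+ 2.
have nd0 x : 0 <= nd x.
  by apply: sumr_ge0 => i _; rewrite mulr_ge0 ?sqr_ge0 ?ltW.
have ndp x : 0 < bil A x x -> 0 < nd x.
  move=> hx; rewrite lt_neqAle nd0 andbT; apply/eqP => h.
  have xi0 i : x 0 i = 0.
    move/esym/eqP: h; rewrite psumr_eq0.
      move/allP => /(_ i); rewrite mem_index_enum => /(_ isT) /=.
      by rewrite mulf_eq0 gt_eqF //= sqrf_eq0 => /eqP.
    by move=> j _; rewrite mulr_ge0 ?sqr_ge0 ?ltW.
  by move: hx; rewrite bilE big1 ?ltxx // => i _; rewrite xi0 mulr0.
pose E : classical_sets.set R := fun a => forall x, bil A x x <= a * nd x.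
have [C C0 hC] := bil_bounded A d0.
have Elb a : E a -> bil A x0 x0 / nd x0 <= a.
  by move=> /(_ x0); rewrite ler_pdivrMr // ndp.
have hE : classical_sets.has_inf E.
  split; first by exists C.
  by exists (bil A x0 x0 / nd x0) => a; exact: Elb.
pose a := inf E.
have Ea : E a.
  move=> x; have [x0'|] := ltP 0 (nd x); last first.
    move=> hx; have {}hx : nd x = 0 by apply/eqP; rewrite eq_le hx nd0.
    by have := hC x; rewrite -/(nd x) hx !mulr0.
  rewrite -ler_pdivrMr //; apply: lb_le_inf; first by case: hE.
  by move=> b /(_ x); rewrite ler_pdivrMr.
have a0 : 0 < a by apply: lt_le_trans (Elb _ Ea); rewrite divr_gt0 // ndp.
pose D := diag_mx (\row_i d i); pose B := a *: D - A.
have DE x i : (x *m D) 0 i = d i * x 0 i.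
  by rewrite mul_mx_diag !mxE mulrC.
have bD x : bil D x x = nd x.
  by rewrite bilE; apply: eq_bigr => i _; rewrite DE -mulrA -expr2.
have bB x y : bil B x y = a * bil D x y - bil A x y.
  by rewrite /bil mulmxBr mulmxBl -scalemxAr -scalemxAl !mxE.
have sB : B^T = B by rewrite linearB /= linearZ /= tr_diag_mx sA.
have Bpsd x : 0 <= bil B x x by rewrite bB bD subr_ge0.
have [/det0P [u u0 uB]|detB] := boolP (\det B == 0).
  exists a, u; split => // i.
  move/rowP/(_ i): uB; rewrite mulmxBr -scalemxAr !mxE.
  move/eqP; rewrite subr_eq0 => /eqP.
  by have := DE u i; rewrite mxE => ->; rewrite mulrA.
have uB : B \in unitmx by rewrite unitmxE unitfE.
have [C' C'0 hC'] := bil_bounded (D *m invmx B *m D) d0.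
suff /(ge_inf (proj2 hE)) : E (a - C'^-1).
  by rewrite -/a lerBrDl gerDr leNgt invr_gt0 C'0.
move=> x; rewrite mulrBl lerBrDr -lerBrDl -bD -bB bD.
(* The form [B] paired with [y] is [D] paired with [x], and B(y,y) <= C' [nd x]. Positivity of [B]
   at x - y/C' then gives B(x,x) >= [nd x] / C', so a - 1/C' is still an upper bound. *)
pose y := x *m D *m invmx B.
have yB : y *m B = x *m D by rewrite mulmxKV.
have byx : bil B x y = nd x by rewrite (bilC _ _ sB) {1}/bil yB -bD.
have byy : bil B y y <= C' * nd x.
  apply: le_trans (hC' x); rewrite /bil yB /y !trmx_mul tr_diag_mx trmx_inv sB.
  by rewrite !mulmxA.
have := Bpsd (x + (- C'^-1) *: y); rewrite bil_sqr // byx => h.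
rewrite -subr_ge0; apply: le_trans h _.
have : C'^-1 ^+ 2 * bil B y y <= C'^-1 * nd x.
  rewrite expr2 -mulrA; apply: ler_wpM2l; first by rewrite invr_ge0 ltW.
  by rewrite ler_pdivrMl.
rewrite sqrrN; lra.
Qed.

End Forms.

(** * Counting positive eigenvalues of symmetric matrices *)

Section Eigen.
Variables (R : realType) (N : nat).
Implicit Types (A H : 'M[R]_N) (x y w u p : 'rV[R]_N).

Definition dot x y : R := \sum_i x 0 i * y 0 i.

Lemma dot_lin x : is_lin (dot x).
Proof.
move=> a y z; rewrite /dot mulr_sumr -big_split /=; apply: eq_bigr => i _.
by rewrite !mxE; ring.
Qed.

Lemma dotC x y : dot x y = dot y x.
Proof. by apply: eq_bigr => i _; rewrite mulrC. Qed.

Lemma dot_ge0 x : 0 <= dot x x.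
Proof. by apply: sumr_ge0 => i _; rewrite -expr2 sqr_ge0. Qed.

Lemma dot_gt0 x : x != 0 -> 0 < dot x x.
Proof.
move=> x0; rewrite lt_neqAle dot_ge0 andbT; apply: contraNneq x0 => /esym/eqP.
rewrite psumr_eq0 => [/allP h|i _]; last by rewrite -expr2 sqr_ge0.
apply/eqP/rowP => i; have := h i (mem_index_enum _).
by rewrite /= mxE -expr2 sqrf_eq0 => /eqP.
Qed.

Lemma bil_dot A x y : bil A x y = dot (x *m A) y.
Proof. exact: bilE. Qed.

(* Deflation: [w] is a [d]-eigenvector with eigenvalue [b]; subtracting its
   contribution from [A] leaves a negative semidefinite form unless some
   [d]-orthogonal eigenvector has a positive eigenvalue. *)
Lemma deflate A (d : 'I_N -> R) w b :
  A^T = A -> (forall i, 0 < d i) -> 0 < b -> w != 0 ->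
  (forall i, (w *m A) 0 i = b * d i * w 0 i) ->
  (forall a u, 0 < a -> u != 0 -> \sum_i d i * w 0 i * u 0 i = 0 ->
     (forall i, (u *m A) 0 i = a * d i * u 0 i) -> False) ->
  hyperbolic (fun x => bil A x x).
Proof.
move=> sA d0 b0 w0 wA no.
pose e := w *m A; pose n := dot e w.
have n0 : 0 < n.
  rewrite /n /dot lt_neqAle; apply/andP; split; last first.
    apply: sumr_ge0 => i _; rewrite wA -(mulrA _ (w 0 i)) -expr2.
    by rewrite mulr_ge0 ?sqr_ge0 // ltW // mulr_gt0.
  apply: contraNneq w0 => /esym/eqP; rewrite psumr_eq0; last first.
    by move=> i _; rewrite wA -(mulrA _ (w 0 i)) -expr2 mulr_ge0 ?sqr_ge0 // ltW // mulr_gt0.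
  move=> /allP h; apply/eqP/rowP => i; have := h i (mem_index_enum _).
  rewrite /= wA -(mulrA _ (w 0 i)) -expr2 mulf_eq0 gt_eqF ?mulr_gt0 //= mxE sqrf_eq0.
  by move/eqP.
pose B := A - n^-1 *: (e^T *m e).
have sB : B^T = B by rewrite linearB /= linearZ /= trmx_mul trmxK sA.
have eu u : u *m e^T = (dot e u)%:M.
  apply/matrixP => i j; rewrite !ord1 !mxE eqxx mulr1n.
  by apply: eq_bigr => k _; rewrite !mxE mulrC.
have uB u : u *m B = u *m A - (n^-1 * dot e u) *: e.
  by rewrite mulmxBr -scalemxAr mulmxA eu mul_scalar_mx scalerA.
have qB x : bil A x x = bil B x x + n^-1 * dot e x ^+ 2.
  rewrite !bil_dot uB [in RHS]dotC.
  have -> : dot x (x *m A - (n^-1 * dot e x) *: e) =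
     dot x (x *m A) - n^-1 * dot e x * dot x e.
    by rewrite -scaleNr is_linD ?is_linZ //; [ring|exact: dot_lin|exact: dot_lin].
  by rewrite (dotC x e) (dotC _ x); ring.
exists n^-1, (dot e); split; first by rewrite invr_ge0 ltW.
  exact: dot_lin.
move=> x; rewrite qB gerDr leNgt; apply/negP => Bx.
have [a [u [a0 u0 hu]]] := pencil_top sB d0 Bx.
(* By the choice of [n], [w] lies in the kernel of [B], so an eigenvector of [B] with eigenvalue a >
   0 is orthogonal to it; on such vectors [A] and [B] agree. *)
have ue : \sum_i d i * w 0 i * u 0 i = 0.
  have : bil B u w = 0.
    rewrite bilC // bil_dot uB -/n mulVf ?gt_eqF // scale1r subrr.
    by rewrite /dot big1 // => i _; rewrite mxE mul0r.
  rewrite bilE (eq_bigr (fun i => a * (d i * w 0 i * u 0 i))).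
    by rewrite -mulr_sumr => /eqP; rewrite mulf_eq0 gt_eqF //= => /eqP.
  by move=> i _; rewrite hu; ring.
apply: (no a u a0 u0 ue) => i; rewrite -hu uB.
have -> : dot e u = 0.
  rewrite /dot (eq_bigr (fun i => b * (d i * w 0 i * u 0 i))).
    by rewrite -mulr_sumr ue mulr0.
  by move=> j _; rewrite wA; ring.
by rewrite mulr0 scale0r subr0.
Qed.

(** Deflation along the positive eigenvector [w]: another positive eigenvector orthogonal to [w] has
    the same eigenvalue by uniqueness, hence lies on the line of [w] by multiplicity one, and is
    zero. *)
Lemma one_pos_hyperbolic A : A^T = A -> one_pos_eigenvalue A ->
  hyperbolic (fun x => bil A x x).
Proof.
move=> sA [a [a0 ra ua]].
have [w wE] : exists2 w : 'rV_N, (w <= eigenspace A a)%MS & w != 0.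
  by apply/rowV0Pn; rewrite -mxrank_eq0 ra.
move=> w0.
have wA : w *m A = a *: w by apply/eigenspaceP.
apply: (@deflate A (fun _ => 1) w a) => //.
  by move=> i; rewrite wA mxE mulr1.
move=> b u b0 u0 wu uA.
have {}uA : u *m A = b *: u by apply/rowP => i; rewrite uA mxE mulr1.
have ab : b = a by apply: ua => //; apply/eigenvalueP; exists u.
have wE' : (eigenspace A a <= w)%MS.
  by rewrite -(mxrank_leqif_sup wE).2 ra rank_rV w0.
have : (u <= w)%MS.
  by apply: submx_trans wE'; apply/eigenspaceP; rewrite uA ab.
case/sub_rVP => c uc; move: wu.
rewrite (eq_bigr (fun i => c * (w 0 i * w 0 i))); last first.
  by move=> i _; rewrite uc !mxE; ring.
rewrite -mulr_sumr => /eqP; rewrite mulf_eq0 (gt_eqF (dot_gt0 w0)) orbF.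
by move=> /eqP c0; move: u0; rewrite uc c0 scale0r eqxx.
Qed.

(** Orthogonal eigenvectors are also orthogonal for the form, so two of them on which the form is
    positive contradict [hyperbolic_orth]. *)
Lemma eigen_orth_hyperbolic A a b x y : A^T = A ->
  hyperbolic (fun x => bil A x x) -> 0 < a -> 0 < b -> x != 0 -> y != 0 ->
  x *m A = a *: x -> y *m A = b *: y -> dot x y = 0 -> False.
Proof.
move=> sA hA a0 b0 x0 y0 xA yA xy.
have dZ c u v : dot (c *: u) v = c * dot u v by rewrite dotC is_linZ ?(dotC u) //; exact: dot_lin.
have := @hyperbolic_orth R N A x y sA hA; rewrite !bil_dot xA yA !dZ xy mulr0.
by move=> /(_ (mulr_gt0 a0 (dot_gt0 x0)) erefl); rewrite leNgt mulr_gt0 ?dot_gt0.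
Qed.

(** The positive vector yields a positive eigenvalue through [pencil_top]; multiplicity and
    uniqueness both reduce to a second eigenvector orthogonal to the first, excluded by
    [eigen_orth_hyperbolic]. *)
Lemma hyperbolic_one_pos A x : A^T = A -> hyperbolic (fun x => bil A x x) ->
  0 < bil A x x -> one_pos_eigenvalue A.
Proof.
move=> sA hA Ax.
have [a [w [a0 w0 wA]]] := pencil_top sA (fun _ => ltr01) Ax.
have {}wA : w *m A = a *: w by apply/rowP => i; rewrite wA mxE mulr1.
have wE : (w <= eigenspace A a)%MS by apply/eigenspaceP.
have dZ c u v : dot (c *: u) v = c * dot u v by rewrite dotC is_linZ ?(dotC u) //; exact: dot_lin.
have proj u : dot w (u + (- (dot w u / dot w w)) *: w) = 0.
  rewrite is_linD ?is_linZ; [|exact: dot_lin..].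
  by rewrite mulNr divfK ?subrr // gt_eqF // dot_gt0.
exists a; split => //.
- apply/eqP; rewrite eqn_leq; apply/andP; split; last first.
    by rewrite lt0n mxrank_eq0; apply/rowV0Pn; exists w.
  have -> : 1%N = \rank w by rewrite rank_rV w0.
  apply: mxrankS; apply/rV_subP => u /eigenspaceP uA.
  pose v := u + (- (dot w u / dot w w)) *: w.
  have vA : v *m A = a *: v.
    by rewrite mulmxDl -scalemxAl uA wA scalerDr !scalerA mulrC.
  have [/eqP|v0] := boolP (v == 0); last first.
    by have := eigen_orth_hyperbolic sA hA a0 a0 w0 v0 wA vA (proj u).
  rewrite /v scaleNr => /eqP; rewrite subr_eq0 => /eqP ->.
  by apply/sub_rVP; eexists.
- move=> b b0 /eigenvalueP [u uA u0]; have [//|ab] := eqVneq b a.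
  suff wu : dot w u = 0.
    by have := eigen_orth_hyperbolic sA hA a0 b0 w0 u0 wA uA wu.
  have := bilC w u sA; rewrite !bil_dot wA uA !dZ (dotC u w) => /eqP.
  rewrite -subr_eq0 -mulrBl mulf_eq0 subr_eq0 eq_sym (negbTE ab) /=.
  by move/eqP.
Qed.

End Eigen.

(** * Perron-Frobenius and the descent from vertex links to the whole form *)

Section Trickle.
Variables (R : realType) (N : nat).
Implicit Types (H : 'M[R]_N) (x u p : 'rV[R]_N).

(** The left side is the Dirichlet energy of [t] on the graph with edge weights H_ij p_i p_j. When
    these weights are nonnegative off the diagonal the energy is nonnegative, and this is how
    Perron-Frobenius enters. *)
Lemma laplacian H p u t : H^T = H -> (forall i, u 0 i = p 0 i * t i) ->
  \sum_i \sum_j H i j * (p 0 i * p 0 j) * (t i - t j) ^+ 2 =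
  (\sum_i (p *m H) 0 i * (p 0 i * t i ^+ 2) - bil H u u) *+ 2.
Proof.
move=> sH uE.
have hs i j : H i j = H j i by rewrite -[in LHS]sH mxE.
have h1 : \sum_i (p *m H) 0 i * (p 0 i * t i ^+ 2) =
   \sum_i \sum_j H i j * (p 0 i * p 0 j) * t i ^+ 2.
  apply: eq_bigr => i _; rewrite mxE mulr_suml; apply: eq_bigr => j _.
  by rewrite (hs i j); ring.
have h2 : \sum_i (p *m H) 0 i * (p 0 i * t i ^+ 2) =
   \sum_i \sum_j H i j * (p 0 i * p 0 j) * t j ^+ 2.
  rewrite h1 exchange_big /=; apply: eq_bigr => i _; apply: eq_bigr => j _.
  by rewrite (hs i j); ring.
have h3 : bil H u u = \sum_i \sum_j H i j * (p 0 i * p 0 j) * (t i * t j).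
  rewrite bilEE; apply: eq_bigr => i _; apply: eq_bigr => j _.
  by rewrite !uE (hs i j); ring.
rewrite mulrnBl mulr2n [in X in X + _ - _]h1 [in X in _ + X - _]h2 h3.
rewrite -big_split /= -sumrMnl -sumrB; apply: eq_bigr => i _.
rewrite -big_split /= -sumrMnl -sumrB; apply: eq_bigr => j _.
ring.
Qed.

(* The inequality forces every positive eigenvalue to be at least 1, while by
   Perron-Frobenius 1 is the largest one and is simple, with eigenvector [p]. *)
Lemma trickling_down H (X : {set 'I_N}) p :
  H^T = H ->
  (forall i j, i \notin X -> H i j = 0) ->
  (forall i j, i != j -> 0 <= H i j) ->
  (forall a : 'I_N -> R, (forall i j, i != j -> 0 < H i j -> a i = a j) ->
     {in X &, forall i j, a i = a j}) ->
  (forall i, i \in X -> 0 < p 0 i) -> (forall i, i \notin X -> p 0 i = 0) ->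
  (forall i, i \in X -> 0 < (p *m H) 0 i) ->
  (forall x, bil H x x <=
     \sum_(i in X) p 0 i * (x *m H) 0 i ^+ 2 / (p *m H) 0 i) ->
  hyperbolic (fun x => bil H x x).
Proof.
move=> sH HX Hnn conn pX pX0 pH ineq.
have hs i j : H i j = H j i by rewrite -[in LHS]sH mxE.
have uHX u i : i \notin X -> (u *m H) 0 i = 0.
  by move=> iX; rewrite mxE big1 // => j _; rewrite hs HX // mulr0.
have [X0|[i0 i0X]] := set_0Vmem X.
  exists 0, (fun=> 0); split => // [a x y|x]; first by rewrite mulr0 addr0.
  by rewrite mul0r bilE big1 // => i _; rewrite uHX ?X0 ?inE // mul0r.
(* The diagonal matrix E on [X]; off [X], where both [p] and the rows of [H] vanish, the value 1
   only keeps [d] positive. *)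
pose d i := if i \in X then (p *m H) 0 i / p 0 i else 1.
have d0 i : 0 < d i by rewrite /d; case: ifP => // iX; rewrite divr_gt0 ?pH ?pX.
have pHd i : (p *m H) 0 i = d i * p 0 i.
  rewrite /d; case: ifPn => iX; first by rewrite divfK // gt_eqF ?pX.
  by rewrite uHX // pX0 ?mulr0.
apply: (@deflate _ _ _ d p 1) => //.
- apply/eqP => p0; move: (pX _ i0X); rewrite p0 mxE ltxx //.
- by move=> i; rewrite mul1r.
move=> a u a0 u0 pu uH.
have uX i : i \notin X -> u 0 i = 0.
  move=> iX; move: (uH i); rewrite uHX // /d (negbTE iX) mulr1 => /esym/eqP.
  by rewrite mulf_eq0 gt_eqF //= => /eqP.
pose S := \sum_i d i * u 0 i ^+ 2.
have S0 : 0 < S.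
  rewrite lt_neqAle; apply/andP; split; last first.
    by apply: sumr_ge0 => i _; rewrite mulr_ge0 ?sqr_ge0 // ltW.
  apply: contraNneq u0 => /esym/eqP; rewrite psumr_eq0 => [/allP h|i _]; last first.
    by rewrite mulr_ge0 ?sqr_ge0 // ltW.
  apply/eqP/rowP => i; have := h i (mem_index_enum _).
  by rewrite /= mulf_eq0 gt_eqF //= sqrf_eq0 mxE => /eqP.
have bu : bil H u u = a * S.
  by rewrite bilE mulr_sumr; apply: eq_bigr => i _; rewrite uH; ring.
(* For the eigenvector [u] the hypothesis reads a S <= a^2 S. *)
have a1 : 1 <= a.
  have := ineq u; rewrite bu.
  have -> : \sum_(i in X) p 0 i * (u *m H) 0 i ^+ 2 / (p *m H) 0 i = a * (a * S).
    rewrite /S [in RHS](bigID (fun i => i \in X)) /=.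
    rewrite [X in _ + X]big1 ?addr0; last first.
      by move=> i iX; rewrite (uX i iX) expr0n mulr0.
    rewrite !mulr_sumr; apply: eq_bigr => i iX; rewrite uH pHd.
    have := pX i iX; have := d0 i; move=> /lt0r_neq0 ? /lt0r_neq0 ?.
    by field; apply/andP.
  rewrite ler_pM2l // -[X in X <= _]mul1r ler_pM2r //.
pose t i := u 0 i / p 0 i.
have ut i : u 0 i = p 0 i * t i.
  have [iX|iX] := boolP (i \in X); first by rewrite mulrC divfK // gt_eqF ?pX.
  by rewrite uX // pX0 ?mul0r.
(* The energy of [t] equals 2 (S - a S), which a >= 1 makes nonpositive; all its terms then vanish
   and [t] is constant on [X]. *)
have lap := laplacian sH ut.
have {}lap : \sum_i \sum_j H i j * (p 0 i * p 0 j) * (t i - t j) ^+ 2 <= 0.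
  rewrite lap bu.
  have -> : \sum_i (p *m H) 0 i * (p 0 i * t i ^+ 2) = S.
    by apply: eq_bigr => i _; rewrite pHd ut; ring.
  by rewrite pmulrn_lle0 // subr_le0 -[X in X <= _]mul1r ler_pM2r.
have p0 i : 0 <= p 0 i.
  by have [/pX/ltW //|/pX0 ->] := boolP (i \in X).
have tge0 i j : 0 <= H i j * (p 0 i * p 0 j) * (t i - t j) ^+ 2.
  have [->|ij] := eqVneq i j; first by rewrite subrr expr0n mulr0.
  by apply: mulr_ge0 (sqr_ge0 _); apply: mulr_ge0 (mulr_ge0 _ _) => //; apply: Hnn.
have tc : {in X &, forall i j, t i = t j}.
  apply: conn => i j ij Hij.
  have iX : i \in X by apply: contraLR Hij => iX; rewrite HX ?ltxx.
  have jX : j \in X by apply: contraLR Hij => jX; rewrite hs HX ?ltxx.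
  have : \sum_i \sum_j H i j * (p 0 i * p 0 j) * (t i - t j) ^+ 2 == 0.
    by rewrite eq_le lap; apply: sumr_ge0 => k _; apply: sumr_ge0.
  rewrite psumr_eq0 => [/allP/(_ i (mem_index_enum _)) /=|k _]; last exact: sumr_ge0.
  rewrite psumr_eq0 // => /allP/(_ j (mem_index_enum _)) /=.
  rewrite mulf_eq0 sqrf_eq0 gt_eqF ?mulr_gt0 ?pX //= subr_eq0.
  by move/eqP.
(* A constant [t] makes [u] a multiple of [p], and orthogonality to [p] forces the factor to be
   0. *)
have ti0 : t i0 = 0.
  move: pu; rewrite (eq_bigr (fun i => t i0 * (d i * p 0 i ^+ 2))).
    rewrite -mulr_sumr => /eqP; rewrite mulf_eq0 => /orP[/eqP //|].
    rewrite psumr_eq0 => [/allP/(_ i0 (mem_index_enum _)) /=|i _]; last first.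
      by rewrite mulr_ge0 ?sqr_ge0 // ltW.
    by rewrite mulf_eq0 sqrf_eq0 !gt_eqF ?pX.
  move=> i _; rewrite ut; have [iX|iX] := boolP (i \in X).
    by rewrite (tc i i0) //; ring.
  by rewrite pX0 //; ring.
case/eqP: u0; apply/rowP => i; rewrite mxE.
have [iX|iX] := boolP (i \in X); last exact: uX.
by rewrite ut (tc i i0) // ti0 mulr0.
Qed.

End Trickle.

(** * Derivatives of homogeneous polynomials *)

Section Derivatives.
Variables (R : realType) (N : nat).
Implicit Types (f g h p q : {mpoly R[N]}) (T U A B : {set 'I_N}).
Implicit Types (u v x y : 'rV[R]_N) (vs : seq 'rV[R]_N).

Lemma mderivm_comm (m m' : 'X_{1..N}) f : f^`M[m]^`M[m'] = f^`M[m']^`M[m].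
Proof. by rewrite -!mderivmDm addmC. Qed.

Lemma mderivmi_comm (m : 'X_{1..N}) i f : f^`M[m]^`M(i) = f^`M(i)^`M[m].
Proof. by rewrite -!mderivmU1m mderivm_comm. Qed.

Lemma dpart0 f : dpart set0 f = f.
Proof. by rewrite /dpart mesym1_set0 mderivm0m. Qed.

Lemma dpart1 i f : dpart [set i] f = f^`M(i).
Proof. by rewrite /dpart mesym1_set1 mderivmU1m. Qed.

Lemma dpartU A B f : [disjoint A & B] -> dpart (A :|: B) f = dpart A (dpart B f).
Proof.
move=> dAB; rewrite /dpart -mderivmDm; congr (_^`M[_]); apply/mnmP => i.
rewrite mnmDE !mnmE inE; have [iA|//] := boolP (i \in A); last first.
  by rewrite addn0.
by rewrite (disjointFr dAB).
Qed.

Lemma dpartU1 i T f : i \notin T -> dpart (i |: T) f = (dpart T f)^`M(i).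
Proof. by move=> iT; rewrite dpartU ?disjoints1 // dpart1. Qed.

Lemma dpartS0 A B f : A \subset B -> dpart A f = 0 -> dpart B f = 0.
Proof.
move=> /setIidPr AB h; rewrite -(setID B A) AB setUC dpartU ?h; last first.
  by rewrite disjoints_subset; apply/subsetP => i; rewrite !inE => /andP[].
exact: raddf0.
Qed.

Lemma DeltaS f A B : A \subset B -> B \in Delta f -> A \in Delta f.
Proof. by move=> AB; rewrite !inE; apply: contra_neq; apply: dpartS0. Qed.

Lemma notin_Delta f T : T \notin Delta f -> dpart T f = 0.
Proof. by rewrite inE negbK => /eqP. Qed.

Lemma Ddir_is_linear u : linear (@Ddir R N u).
Proof.
move=> a f g; rewrite /Ddir scaler_sumr -big_split; apply: eq_bigr => i _ /=.
by rewrite mderivD mderivZ scalerDr !scalerA mulrC.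
Qed.
HB.instance Definition _ u :=
  GRing.isLinear.Build R {mpoly R[N]} {mpoly R[N]} _ (@Ddir R N u) (Ddir_is_linear u).

Lemma Ddir_sum u (I : Type) (r : seq I) (P : pred I) (F : I -> {mpoly R[N]}) :
  Ddir u (\sum_(i <- r | P i) F i) = \sum_(i <- r | P i) Ddir u (F i).
Proof. exact: linear_sum. Qed.

Lemma mderiv_sum i (I : Type) (r : seq I) (P : pred I) (F : I -> {mpoly R[N]}) :
  (\sum_(j <- r | P j) F j)^`M(i) = \sum_(j <- r | P j) (F j)^`M(i).
Proof. exact: linear_sum. Qed.

Lemma mcoeff_sum m (I : Type) (r : seq I) (P : pred I) (F : I -> {mpoly R[N]}) :
  (\sum_(i <- r | P i) F i)@_m = \sum_(i <- r | P i) (F i)@_m.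
Proof. exact: raddf_sum. Qed.

Lemma meval_sum (x : 'I_N -> R) (I : Type) (r : seq I) (P : pred I)
    (F : I -> {mpoly R[N]}) :
  (\sum_(i <- r | P i) F i).@[x] = \sum_(i <- r | P i) (F i).@[x].
Proof. exact: raddf_sum. Qed.

Lemma DdirD u v f : Ddir (u + v) f = Ddir u f + Ddir v f.
Proof.
by rewrite /Ddir -big_split; apply: eq_bigr => i _ /=; rewrite mxE scalerDl.
Qed.

Lemma DdirZ a u f : Ddir (a *: u) f = a *: Ddir u f.
Proof.
by rewrite /Ddir scaler_sumr; apply: eq_bigr => i _ /=; rewrite mxE scalerA.
Qed.

Lemma Ddir_mderivm u (m : 'X_{1..N}) f : Ddir u f^`M[m] = (Ddir u f)^`M[m].
Proof.
rewrite /Ddir raddf_sum; apply: eq_bigr => i _ /=.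
by rewrite linearZ /= mderivmi_comm.
Qed.

Lemma Ddir_mderiv u i f : Ddir u f^`M(i) = (Ddir u f)^`M(i).
Proof. by rewrite -!mderivmU1m Ddir_mderivm. Qed.

Lemma Ddir_comm u v f : Ddir u (Ddir v f) = Ddir v (Ddir u f).
Proof.
rewrite {1}/Ddir [RHS]raddf_sum; apply: eq_bigr => i _ /=.
by rewrite -Ddir_mderiv linearZ.
Qed.

Lemma Ddirs_Ddir vs v f : Ddirs vs (Ddir v f) = Ddir v (Ddirs vs f).
Proof. by elim: vs => //= u vs ->; rewrite Ddir_comm. Qed.

Lemma Ddirs_mderivm vs (m : 'X_{1..N}) f : Ddirs vs f^`M[m] = (Ddirs vs f)^`M[m].
Proof. by elim: vs => //= u vs ->; rewrite Ddir_mderivm. Qed.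

Lemma Ddirs_mderiv vs i f : Ddirs vs f^`M(i) = (Ddirs vs f)^`M(i).
Proof. by rewrite -!mderivmU1m Ddirs_mderivm. Qed.

Lemma Ddirs0 vs : Ddirs vs (0 : {mpoly R[N]}) = 0.
Proof. by elim: vs => //= u vs ->; rewrite raddf0. Qed.

Lemma eq_Ddir u v f :
  (forall i, f^`M(i) != 0 -> u 0 i = v 0 i) -> Ddir u f = Ddir v f.
Proof.
move=> h; apply: eq_bigr => i _; have [->|/h -> //] := eqVneq (f^`M(i)) 0.
by rewrite !scaler0.
Qed.

Lemma homogPc d f :
  reflect (forall m, f@_m != 0 -> mdeg m = d) (f \is d.-homog).
Proof.
apply: (iffP (dhomogP _ _ _)) => h m hm; apply: h; move: hm => /=;
  by rewrite mcoeff_msupp.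
Qed.

Lemma homog_mderiv d i f : f \is d.-homog -> f^`M(i) \is d.-1.-homog.
Proof.
move=> /homogPc h; apply/homogPc => m; rewrite mcoeff_mderiv => hm.
have := h (m + U_(i))%MM; rewrite mdegD mdeg1 addn1 => <- //.
by apply: contraNneq hm => ->; rewrite mul0rn.
Qed.

Lemma homog0_mderiv i f : f \is 0.-homog -> f^`M(i) = 0.
Proof.
move=> /homogPc h; apply/mpolyP => m; rewrite mcoeff_mderiv mcoeff0.
have [->|/h] := eqVneq (f@_(m + U_(i))) 0; first by rewrite mul0rn.
by rewrite mdegD mdeg1 addn1.
Qed.

Lemma homog_mderivm d (m : 'X_{1..N}) f :
  f \is d.-homog -> f^`M[m] \is (d - mdeg m).-homog.
Proof.
move=> /homogPc h; apply/homogPc => m'; rewrite mcoeff_mderivm => hm.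
have := h (m + m')%MM; rewrite mdegD => <-; first by rewrite addKn.
by apply: contraNneq hm => ->; rewrite mul0rn.
Qed.

Lemma homog_mderivm0 d (m : 'X_{1..N}) f :
  f \is d.-homog -> (d < mdeg m)%N -> f^`M[m] = 0.
Proof.
move=> /homogPc h dm; apply/mpolyP => m'; rewrite mcoeff_mderivm mcoeff0.
have [->|/h] := eqVneq (f@_(m + m')) 0; first by rewrite mul0rn.
by rewrite mdegD => e; move: dm; rewrite -e ltnNge leq_addr.
Qed.

Lemma homog_dpart d T f : f \is d.-homog -> dpart T f \is (d - #|T|).-homog.
Proof. by move=> /(homog_mderivm (mesym1 T)); rewrite mdeg_mesym1. Qed.

Lemma card_Delta d f T : f \is d.-homog -> T \in Delta f -> (#|T| <= d)%N.
Proof.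
move=> hf; rewrite inE leqNgt; apply: contra_neqN => h.
by rewrite /dpart (homog_mderivm0 hf) // mdeg_mesym1.
Qed.

Lemma homog_Ddir d u f : f \is d.-homog -> Ddir u f \is d.-1.-homog.
Proof.
move=> hf; apply: rpred_sum => i _; apply: dhomogZ; exact: homog_mderiv.
Qed.

Lemma homog_Ddirs d vs f : f \is d.-homog -> Ddirs vs f \is (d - size vs).-homog.
Proof.
move=> hf; elim: vs => /= [|u vs ih]; first by rewrite subn0.
by rewrite subnS homog_Ddir.
Qed.

Lemma homog0C f : f \is 0.-homog -> f = (f@_0%MM)%:MP.
Proof.
move=> /homogPc h; apply/mpolyP => m; rewrite mcoeffC.
have [<-|m0] := eqVneq 0%MM m; first by rewrite mulr1.
rewrite mulr0; apply/eqP; apply: contraNT m0 => /h /eqP.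
by rewrite mdeg_eq0 eq_sym.
Qed.

Lemma homog_degree d f : f \is d.-homog -> f != 0 -> degree f = d.
Proof.
move=> hf f0; have /dhomog_uniq := dhomog_msize hf.
by move=> h; symmetry; apply: dhomog_uniq hf (dhomog_msize hf).
Qed.

Lemma homog_degreeE f : homogeneous f -> f \is (degree f).-homog.
Proof. by case=> d /dhomog_msize. Qed.

Lemma mderiv_poly_in i f : f^`M(i) = 0 <-> (forall m, m \in msupp f -> m i = 0%N).
Proof.
split=> [h m|h]; last first.
  apply/mpolyP => m; rewrite mcoeff_mderiv mcoeff0 memN_msupp_eq0 ?mul0rn //.
  by apply/negP => /h; rewrite mnmDE mnm1E eqxx addn1.
rewrite mcoeff_msupp; case E : (m i) => [//|k] /eqP[].
move/mpolyP/(_ (m - U_(i))%MM): h; rewrite mcoeff_mderiv mcoeff0 submK ?lep1mP ?E //.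
by move/eqP; rewrite mulrn_eq0 /= => /eqP.
Qed.

Lemma poly_in_mderiv V f : poly_in V f <-> (forall i, i \notin V -> f^`M(i) = 0).
Proof.
split=> [h i iV|h m hm i iV]; first by apply/mderiv_poly_in => m /h; apply.
by move/mderiv_poly_in: (h i iV); apply.
Qed.

Lemma homog_mderiv_neq0 d f : f \is d.+1.-homog -> f != 0 -> exists i, f^`M(i) != 0.
Proof.
move=> hf; rewrite -msupp_eq0; case E : (msupp f) => [//|m s] _.
have mf : m \in msupp f by rewrite E inE eqxx.
have : mdeg m != 0%N by rewrite (dhomog_mf hf).
rewrite mdegE sum_nat_eq0 negb_forall => /existsP[i mi].
exists i; apply: contraNneq mi => /mderiv_poly_in h.
by apply/implyP => _; rewrite h.
Qed.

Lemma Delta_mderiv f i : (i \in vertices (Delta f)) = (f^`M(i) != 0).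
Proof. by rewrite !inE dpart1. Qed.

Definition spans_on (L : 'rV[R]_N -> Prop) T :=
  forall a : 'I_N -> R, exists2 l, L l & forall i, i \in T -> l 0 i = a i.

(* A derivative in a direction of [T] is, along the lineality space, a
   combination of derivatives in directions outside [T]. *)
Lemma exists_mderiv_off d f T : f \is d.+1.-homog -> f != 0 ->
  spans_on (fun l => Ddir l f = 0) T -> exists2 j, j \notin T & f^`M(j) != 0.
Proof.
move=> hf f0 sp; have [i fi] := homog_mderiv_neq0 hf f0.
have [[j /andP[jT fj]]|no] :=
    altP (@existsP _ (fun j => (j \notin T) && (f^`M(j) != 0))).
  by exists j.
have [l hl li] := sp (fun j => (j == i)%:R).
case/eqP: fi; have [iT|iT] := boolP (i \in T); last first.
  apply/eqP; apply: contraNT no => fi; apply/existsP; exists i.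
  by rewrite iT.
rewrite -[RHS]hl /Ddir (bigD1 i) //= li // eqxx scale1r big1 ?addr0 // => j ji.
have [jT|jT] := boolP (j \in T); first by rewrite li // (negbTE ji) scale0r.
suff -> : f^`M(j) = 0 by rewrite scaler0.
apply/eqP; apply: contraNT no => fj; apply/existsP; exists j.
by rewrite jT.
Qed.

Definition kill T f : {mpoly R[N]} :=
  f \mPo [tuple (if i \in T then 0 else 'X_i) | i < N].

Lemma contractE f T : contract f T = kill T (dpart T f).
Proof. by []. Qed.

Lemma kill_is_linear T : linear (kill T).
Proof. by move=> a f g; rewrite /kill linearP. Qed.
HB.instance Definition _ T :=
  GRing.isLinear.Build R {mpoly R[N]} {mpoly R[N]} _ (kill T) (kill_is_linear T).

Lemma kill_sum T (I : Type) (r : seq I) (P : pred I) (F : I -> {mpoly R[N]}) :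
  kill T (\sum_(i <- r | P i) F i) = \sum_(i <- r | P i) kill T (F i).
Proof. exact: linear_sum. Qed.

Lemma mcoeff_kill T f m :
  (kill T f)@_m = if [forall i in T, m i == 0%N] then f@_m else 0.
Proof.
have kX m' : kill T 'X_[m'] = if [forall i in T, m' i == 0%N] then 'X_[m'] else 0.
  rewrite /kill comp_mpolyX; case: ifPn => [/forall_inP h|].
    rewrite mpolyXE_id; apply: eq_bigr => i _; rewrite tnth_mktuple.
    by case: ifP => // /h /eqP ->; rewrite !expr0.
  rewrite negb_forall_in => /exists_inP[i iT mi].
  by rewrite (bigD1 i) //= tnth_mktuple iT expr0n (negbTE mi) mul0r.
have -> : (kill T f)@_m = \sum_(m' <- msupp f) f@_m' * (kill T 'X_[m'])@_m.
  rewrite [in LHS](mpolyE f) kill_sum raddf_sum; apply: eq_bigr => m' _.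
  by rewrite linearZ /= mcoeffZ.
have -> : f@_m = \sum_(m' <- msupp f) f@_m' * (m' == m)%:R.
  rewrite [in LHS](mpolyE f) raddf_sum /=; apply: eq_bigr => m' _.
  by rewrite mcoeffZ mcoeffX.
case: ifPn => hm; last apply: big1 => m' _.
  apply: eq_bigr => m' _; rewrite kX; congr (_ * _).
  case: ifPn; first by rewrite mcoeffX.
  by rewrite mcoeff0; case: eqP => // ->; rewrite hm.
rewrite kX; case: ifPn; last by rewrite mcoeff0 mulr0.
rewrite mcoeffX; case: eqP => [->|_]; last by rewrite mulr0.
by rewrite (negbTE hm).
Qed.

Lemma kill_mderiv T i f : i \notin T -> (kill T f)^`M(i) = kill T f^`M(i).
Proof.
move=> iT; apply/mpolyP => m; rewrite mcoeff_mderiv !mcoeff_kill mcoeff_mderiv.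
have -> : [forall j in T, (m + U_(i))%MM j == 0%N] = [forall j in T, m j == 0%N].
  apply: eq_forallb => j; have [jT|//] := boolP (j \in T).
  rewrite mnmDE mnm1E; case: (i =P j) => [ij|_]; last by rewrite addn0.
  by move: iT; rewrite ij jT.
by case: ifP => //; rewrite mul0rn.
Qed.

Lemma kill_mderiv0 T i f : i \in T -> (kill T f)^`M(i) = 0.
Proof.
move=> iT; apply/mpolyP => m; rewrite mcoeff_mderiv !mcoeff_kill mcoeff0.
case: ifP => [/forall_inP/(_ i iT)|]; last by rewrite mul0rn.
by rewrite mnmDE mnm1E eqxx addn1.
Qed.

Lemma kill_dpart T U f : [disjoint U & T] -> dpart U (kill T f) = kill T (dpart U f).
Proof.
have [n le_n] := ubnP #|U|; elim: n U le_n f => // n ih U le_n f UT.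
have [->|[i iU]] := set_0Vmem U; first by rewrite !dpart0.
have iT : i \notin T by rewrite (disjointFr UT).
rewrite -(setD1K iU) !dpartU1 ?setD11 // ih ?kill_mderiv //.
  by move: le_n; rewrite (cardsD1 i U) iU.
by apply: disjointWl UT; apply: subD1set.
Qed.

Lemma kill_kill T U f : kill U (kill T f) = kill (T :|: U) f.
Proof.
apply/mpolyP => m; rewrite !mcoeff_kill.
have -> : [forall i in T :|: U, m i == 0%N] =
    [forall i in U, m i == 0%N] && [forall i in T, m i == 0%N].
  apply/forall_inP/andP => [h|[/forall_inP hU /forall_inP hT] i].
    by split; apply/forall_inP => i iT; apply: h; rewrite inE iT ?orbT.
  by rewrite inE => /orP[/hT|/hU].
by case: ifP.
Qed.

Lemma kill0E f : kill set0 f = f.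
Proof.
apply/mpolyP => m; rewrite mcoeff_kill; case: ifPn => //.
by rewrite negb_forall_in => /exists_inP[i]; rewrite inE.
Qed.

Lemma homog_kill d T f : f \is d.-homog -> kill T f \is d.-homog.
Proof.
move=> /homogPc h; apply/homogPc => m; rewrite mcoeff_kill.
by case: ifP => [_ /h|_ /eqP].
Qed.

Lemma kill_coef0 T f : (kill T f)@_0%MM = f@_0%MM.
Proof.
rewrite mcoeff_kill ifT //; apply/forall_inP => i _.
by rewrite mnm0E.
Qed.

Lemma kill_Ddir T v f : (forall i, i \in T -> v 0 i = 0) ->
  Ddir v (kill T f) = kill T (Ddir v f).
Proof.
move=> v0; rewrite /Ddir kill_sum; apply: eq_bigr => i _.
rewrite linearZ /=; have [iT|iT] := boolP (i \in T).
  by rewrite v0 // !scale0r.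
by rewrite kill_mderiv.
Qed.

(** Derivatives in directions outside [T] commute with [kill T], and [exists_mderiv_off] always
    provides a nonzero one; descending to degree 0 leaves a nonzero constant, which [kill] does not
    change. *)
Lemma kill_neq0 d T f : f \is d.-homog -> f != 0 ->
  spans_on (fun l => Ddir l f = 0) T -> kill T f != 0.
Proof.
elim: d f => [|d ih] f hf f0 sp.
  apply: contraNneq f0 => k0; rewrite (homog0C hf) -(kill_coef0 T) k0.
  by rewrite mcoeff0 mpolyC0.
have [j jT fj] := exists_mderiv_off hf f0 sp.
have : kill T f^`M(j) != 0.
  apply: ih => //; first exact: (homog_mderiv _ hf).
  by move=> a; have [l hl la] := sp a; exists l => //; rewrite Ddir_mderiv hl raddf0.
by rewrite -kill_mderiv //; apply: contra_neq => ->; rewrite raddf0.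
Qed.

Lemma form_mx_sym f : (form_mx f)^T = form_mx f.
Proof. by apply/matrixP => i j; rewrite !mxE mderiv_comm. Qed.

Lemma bil_form f x y : bil (form_mx f) x y = (Ddir x (Ddir y f))@_0%MM.
Proof.
rewrite bilEE {2}/Ddir Ddir_sum mcoeff_sum; apply: eq_bigr => i _.
rewrite linearZ /= mcoeffZ /Ddir mcoeff_sum mulr_sumr; apply: eq_bigr => j _.
by rewrite mcoeffZ mxE mderiv_comm; ring.
Qed.

Lemma form_row f x i : (x *m form_mx f) 0 i = (Ddir x f^`M(i))@_0%MM.
Proof.
rewrite mxE /Ddir mcoeff_sum; apply: eq_bigr => j _.
by rewrite mcoeffZ mxE mderiv_comm.
Qed.

Lemma euler d f (x : 'rV[R]_N) : f \is d.-homog ->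
  (Ddir x f).@[x 0] = d%:R * f.@[x 0].
Proof.
move=> hf; rewrite /Ddir [f in LHS]mpolyE [f in RHS]mpolyE.
rewrite !meval_sum mulr_sumr.
under eq_bigr => i _ do rewrite mevalZ mderiv_sum meval_sum mulr_sumr.
rewrite exchange_big /=; rewrite !big_seq; apply: eq_bigr => m hm.
have <- : mdeg m = d := dhomog_mf hf hm.
rewrite mdegE natr_sum mulr_suml; apply: eq_bigr => i _.
rewrite mderivZ mderivX !mevalZ !mevalX.
case E : (m i) => [|k]; first by rewrite !mul0r !mulr0.
rewrite (bigD1 i) //= [in RHS](bigD1 i) //= mnmBE mnm1E eqxx E subn1 exprS /=.
rewrite (eq_bigr (fun j => x 0 j ^+ m j)); first by ring.
by move=> j ji; rewrite mnmBE mnm1E eq_sym (negbTE ji) subn0.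
Qed.

Lemma meval_homog0 f (x : 'I_N -> R) : f \is 0.-homog -> f.@[x] = f@_0%MM.
Proof. by move=> /homog0C ->; rewrite mevalC mcoeffC eqxx mulr1. Qed.

Lemma meval_homog1 f x : f \is 1.-homog -> f.@[x 0] = (Ddir x f)@_0%MM.
Proof.
move=> hf; have := euler x hf; rewrite mul1r => <-.
by rewrite meval_homog0 //; apply: (homog_Ddir _ hf).
Qed.

Lemma meval_homog2 f x : f \is 2.-homog ->
  f.@[x 0] = 2^-1 * bil (form_mx f) x x.
Proof.
move=> hf; have := euler x hf; rewrite meval_homog1 ?(homog_Ddir _ hf) //.
by rewrite bil_form => ->; rewrite mulKf // pnatr_eq0.
Qed.

Lemma pos_constE f : f \is 0.-homog -> pos_const f <-> 0 < f@_0%MM.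
Proof.
move=> hf; split=> [[a a0 ->]|h]; first by rewrite mcoeffC eqxx mulr1.
by exists (f@_0%MM) => //; apply: homog0C.
Qed.

End Derivatives.

(** * Contractions and the local condition *)

Section Contraction.
Variables (R : realType) (N : nat).
Implicit Types (f g h : {mpoly R[N]}) (V T U F G : {set 'I_N}) (x v : 'rV[R]_N).

Lemma in_linkV f T i : (i \in linkV f T) = (i \notin T) && (i |: T \in Delta f).
Proof.
rewrite /linkV /vertices /link inE inE; congr (_ && _).
by rewrite powersetE sub1set inE.
Qed.

Lemma dpart_contract f T U : [disjoint U & T] ->
  dpart U (contract f T) = kill T (dpart (U :|: T) f).
Proof. by move=> UT; rewrite contractE kill_dpart // dpartU. Qed.

Lemma dpart_contract0 f T U : ~~ [disjoint U & T] -> dpart U (contract f T) = 0.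
Proof.
case/pred0Pn => i /= /andP[iU iT]; apply: (@dpartS0 _ _ [set i]).
  by rewrite sub1set.
by rewrite dpart1 contractE kill_mderiv0.
Qed.

Lemma contract_contract f T U : [disjoint U & T] ->
  contract (contract f T) U = contract f (U :|: T).
Proof.
by move=> UT; rewrite contractE dpart_contract // kill_kill setUC -contractE.
Qed.

Lemma homog_contract d f T : f \is d.-homog -> contract f T \is (d - #|T|).-homog.
Proof. by move=> hf; apply: homog_kill; apply: homog_dpart. Qed.

(** A variable outside [T] and outside the link cannot occur in [dpart T f], since adding it to [T]
    gives a non-face. *)
Lemma restrict_linkV f T v : (forall i, i \in T -> v 0 i = 0) ->
  Ddir (restrict (linkV f T) v) (dpart T f) = Ddir v (dpart T f).
Proof.
move=> vT; apply: eq_Ddir => i fi; rewrite mxE; case: ifPn => //.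
rewrite in_linkV negb_and negbK => /orP[/vT //|/notin_Delta].
have [/vT //|iT] := boolP (i \in T).
by rewrite dpartU1 // => fi0; rewrite fi0 eqxx in fi.
Qed.

Lemma restrict_off f T v i : i \in T -> restrict (linkV f T) v 0 i = 0.
Proof. by move=> iT; rewrite mxE in_linkV iT. Qed.

Section StronglyHereditary.
Variables (V : {set 'I_N}) (f : {mpoly R[N]}) (d : nat).
Hypotheses (sf : strongly_hereditary V f) (hf : f \is d.-homog).

Lemma sh_spans T U : T \in Delta f ->
  spans_on (fun l => Ddir l (dpart U f) = 0) T.
Proof.
case: sf => _ _ her /her {}her a; have [l [_ lf] la] := her a.
by exists l => //; rewrite Ddir_mderivm lf raddf0.
Qed.

Lemma dpart_kill_neq0 T U : T \in Delta f -> (kill T (dpart U f) != 0) = (dpart U f != 0).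
Proof.
move=> TD; apply/idP/idP; first by apply: contra_neq => ->; rewrite raddf0.
move=> U0; exact: (kill_neq0 (homog_dpart U hf) U0 (sh_spans U TD)).
Qed.

(** Heredity is what keeps faces of the link from being lost when the variables of [T] are set to 0,
    through [kill_neq0]. *)
Lemma Delta_contract T : T \in Delta f -> Delta (contract f T) = link (Delta f) T.
Proof.
move=> TD; apply/setP => U; rewrite /link !inE -disjoints_subset.
have [UT|UT] := boolP [disjoint U & T]; last by rewrite dpart_contract0 ?eqxx.
by rewrite dpart_contract // dpart_kill_neq0.
Qed.

Lemma vertices_linkV T : T \in Delta f -> vertices (Delta (contract f T)) = linkV f T.
Proof. by move=> TD; rewrite Delta_contract. Qed.

Lemma Delta_grow T : T \in Delta f -> (#|T| < d)%N ->
  exists2 j, j \notin T & j |: T \in Delta f.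
Proof.
move=> TD Td; have hT := homog_dpart T hf.
rewrite -(ltn_predK (_ : 0 < d - #|T|)%N) ?subn_gt0 // in hT.
have T0 : dpart T f != 0 by move: TD; rewrite inE.
have [j jT jf] := exists_mderiv_off hT T0 (sh_spans T TD).
by exists j => //; rewrite inE dpartU1.
Qed.

(** Purity of the complex: below degree d the derivative along a face is nonzero of positive degree,
    and heredity gives it a nonzero derivative off the face. *)
Lemma Delta_facet T : T \in Delta f ->
  exists F, [/\ T \subset F, F \in Delta f & #|F| = d].
Proof.
have [n le_n] := ubnP (d - #|T|)%N; elim: n T le_n => // n ih T le_n TD.
have := card_Delta hf TD; rewrite leq_eqVlt => /orP[/eqP Td|Td].
  by exists T.
have [j jT jTD] := Delta_grow TD Td.
have [||F [jF FD Fd]] := ih (j |: T) => //.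
  by rewrite cardsU1 jT add1n; move: le_n; lia.
by exists F; split => //; apply: subset_trans jF; apply: subsetU1.
Qed.

Lemma sh_contract T : T \in Delta f ->
  strongly_hereditary (linkV f T) (contract f T).
Proof.
move=> TD; split.
- apply/poly_in_mderiv => i; rewrite -vertices_linkV // Delta_mderiv negbK.
  by move/eqP.
- by exists (d - #|T|)%N; apply: homog_contract.
move=> U; rewrite Delta_contract // inE powersetE => /andP[UT UTD] a.
case: (sf) => _ _ /(_ _ UTD) her.
(* Prescribing 0 on [T] makes the direction commute with [kill T], so it stays in the lineality
   space after contraction. *)
have [l [_ lf] la] := her (fun i => if i \in T then 0 else a i).
have lT i : i \in T -> l 0 i = 0 by move=> iT; rewrite la ?inE iT ?orbT.
exists (restrict (linkV f T) l); first split.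
- by move=> i iL; rewrite mxE (negbTE iL).
- rewrite contractE kill_Ddir ?restrict_linkV //; last by move=> i; apply: restrict_off.
  by rewrite Ddir_mderivm lf !raddf0.
move=> i iU; rewrite mxE in_linkV.
have iT : i \notin T by move/subsetP: UT => /(_ i iU); rewrite inE.
rewrite iT (DeltaS _ UTD) ?la ?inE ?iU ?(negbTE iT) //.
by apply/subsetP => j; rewrite !inE => /orP[/eqP ->|->]; rewrite ?iU ?orbT.
Qed.

End StronglyHereditary.

(** Selected by cardinality; by [Delta_facet] these are the maximal faces when [f] is strongly
    hereditary of degree [d]. *)
Definition facets d f := [set F in Delta f | #|F| == d].

(** Ranging over all sets of size [d] is harmless, since a non-face has coefficient 0, and it saves
    checking membership along subdivisions. Strictness on facets returns from the coefficient being
    nonzero. *)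
Definition nonneg_facets d f := forall F, #|F| = d -> 0 <= (dpart F f)@_0%MM.

Definition hyperbolic_links d f :=
  forall T, #|T|.+2 = d -> hyperbolic (fun x => (dpart T f).@[x 0]).

(* Strong connectedness of the stars (facets being adjacent when they share a
   ridge), in terms of two-colourings instead of paths. *)
Definition connected_stars d f :=
  forall T (phi : {set 'I_N} -> bool),
    {in facets d f &, forall F G, T \subset F -> T \subset G ->
       (d <= #|F :&: G|.+1)%N -> phi F = phi G} ->
    {in facets d f &, forall F G, T \subset F -> T \subset G -> phi F = phi G}.

Definition locally_lorentzian d f :=
  [/\ nonneg_facets d f, hyperbolic_links d f & connected_stars d f].

Lemma hyperbolic_comp (q : 'rV[R]_N -> R) (s : 'rV[R]_N -> 'rV[R]_N) :
  (forall a x y, s (a *: x + y) = a *: s x + s y) ->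
  hyperbolic q -> hyperbolic (fun x => q (s x)).
Proof.
move=> sl [c [l [c0 hl hq]]]; exists c, (fun x => l (s x)); split => // [a x y].
by rewrite sl hl.
Qed.

Lemma eq_hyperbolic (q q' : 'rV[R]_N -> R) : q =1 q' -> hyperbolic q -> hyperbolic q'.
Proof. by move=> e [c [l [c0 hl hq]]]; exists c, l; split => // x; rewrite -e. Qed.

Lemma hyperbolic0 : hyperbolic (fun _ : 'rV[R]_N => 0).
Proof.
by exists 0, (fun=> 0); split => // [a x y|x]; rewrite ?mulr0 ?addr0 ?mul0r.
Qed.

Definition zero_on T x : 'rV[R]_N := \row_i (if i \in T then 0 else x 0 i).

Lemma zero_on_linear T a x y : zero_on T (a *: x + y) = a *: zero_on T x + zero_on T y.
Proof. by apply/rowP => i; rewrite !mxE; case: ifP => //; rewrite mulr0 addr0. Qed.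

Lemma meval_kill T h x : (kill T h).@[x 0] = h.@[zero_on T x 0].
Proof.
rewrite /kill comp_mpoly_meval; apply: meval_eq => i.
by rewrite tnth_mktuple mxE; case: ifP; rewrite ?meval0 ?mevalXU.
Qed.

Lemma cardsU_disjoint U T : [disjoint U & T] -> #|U :|: T| = (#|U| + #|T|)%N.
Proof. by rewrite -(leq_card_setU U T).2 => /eqP. Qed.

Lemma nonneg_facets_contract f d T : f \is d.-homog ->
  nonneg_facets d f -> T \in Delta f -> nonneg_facets (d - #|T|)%N (contract f T).
Proof.
move=> hf pos TD F Fd; have [FT|FT] := boolP [disjoint F & T]; last first.
  by rewrite dpart_contract0 // mcoeff0.
rewrite dpart_contract // kill_coef0 pos // cardsU_disjoint // Fd subnK //.
exact: card_Delta hf TD.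
Qed.

(** The facets of the link are the facets through [T] with [T] removed, so a colouring [phi] of them
    is pulled back to the star of [U :|: T] by [phi (K :\: T)]; adjacency is unaffected because [T]
    lies in both facets. *)
Lemma locally_lorentzian_contract V f d T :
  strongly_hereditary V f -> f \is d.-homog ->
  locally_lorentzian d f -> T \in Delta f ->
  locally_lorentzian (d - #|T|)%N (contract f T).
Proof.
move=> sf hf [pos hyp conn] TD; have Td := card_Delta hf TD.
have cardUT := @cardsU_disjoint ^~ T.
split; first exact: nonneg_facets_contract.
- move=> U Ud; have [UT|UT] := boolP [disjoint U & T]; last first.
    by apply: eq_hyperbolic hyperbolic0 => x; rewrite dpart_contract0 // meval0.
  have /hyp : #|U :|: T|.+2 = d by rewrite cardUT //; lia.
  move/(hyperbolic_comp (zero_on_linear T)); apply: eq_hyperbolic => x.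
  by rewrite dpart_contract // meval_kill.
have facE F : (F \in facets (d - #|T|)%N (contract f T)) =
    [disjoint F & T] && (F :|: T \in facets d f).
  rewrite [LHS]inE [in RHS]inE (Delta_contract sf hf TD) inE powersetE -disjoints_subset.
  have [FT|//] := boolP [disjoint F & T]; rewrite /= cardUT //.
  by congr (_ && _); apply/eqP/eqP => h; rewrite ?h ?subnK // -h addnK.
move=> U phi hphi F G; rewrite !facE => /andP[FT FTf] /andP[GT GTf] UF UG.
have TK (K : {set 'I_N}) : [disjoint K & T] -> (K :|: T) :\: T = K.
  by move=> KT; rewrite setDUl setDv setU0; apply/setDidPl.
rewrite -(TK F) // -(TK G) //.
move: (FTf) (GTf) (setSU T UF) (setSU T UG).
apply: (conn (U :|: T) (fun K => phi (K :\: T))).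
move=> F' G' F'f G'f; rewrite !subUset => /andP[UF' TF'] /andP[UG' TG'] adj.
have DT (K : {set 'I_N}) : [disjoint K :\: T & T].
  by rewrite disjoints_subset; apply/subsetP => i; rewrite !inE => /andP[].
have KD (K : {set 'I_N}) : T \subset K -> (K :\: T) :|: T = K.
  by move=> /setIidPr TK'; rewrite -[RHS](setID K T) TK' setUC.
have UT : [disjoint U & T] by apply: disjointWl UF FT.
have UKT (K : {set 'I_N}) : U \subset K -> U \subset K :\: T.
  by move=> UK; rewrite subsetD UK UT.
apply: hphi; rewrite ?facE ?DT ?KD ?UKT //.
have TI : T \subset F' :&: G' by rewrite subsetI TF'.
rewrite -setDIl cardsD (setIidPr TI) -subSn ?leq_sub2r //.
exact: subset_leq_card.
Qed.

End Contraction.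

(** * Subdivisions *)

Section Hpart.
Variables (R : realType) (N : nat) (c : 'I_N -> R).
Implicit Types (f u : {mpoly R[N]}) (K S T : {set 'I_N}).

Lemma hpart_is_linear K k : linear (hpart c K k : {mpoly R[N]} -> _).
Proof.
move=> a f u; rewrite /hpart scaler_sumr -big_split; apply: eq_bigr => m _ /=.
by rewrite mderivmD mderivmZ scalerDr !scalerA mulrC.
Qed.
HB.instance Definition _ K k :=
  GRing.isLinear.Build R {mpoly R[N]} {mpoly R[N]} _ (hpart c K k)
    (hpart_is_linear K k).

Lemma hpart_mderivm K k m u : hpart c K k u^`M[m] = (hpart c K k u)^`M[m].
Proof.
rewrite [RHS]linear_sum; apply: eq_bigr => m' _.
by rewrite [RHS]linearZ /= mderivm_comm.
Qed.

Lemma hpart_mderiv K k i u : hpart c K k u^`M(i) = (hpart c K k u)^`M(i).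
Proof. by rewrite -!mderivmU1m hpart_mderivm. Qed.

Lemma hpart0 K u : hpart c K 0 u = u.
Proof.
rewrite /hpart (bigD1 bm0) /=; last first.
  by rewrite mdeg0 eqxx; apply/forallP => i; rewrite mnm0E eqxx implybT.
rewrite mderivm0m big1 ?scale1r => [|m].
  rewrite big1 ?addr0 // => m /andP[/andP[/eqP m0 _] /eqP[]]; apply: val_inj.
  by apply/eqP; rewrite -mdeg_eq0 m0.
by move=> _; rewrite mnm0E expr0 invr1.
Qed.

Lemma homog_hpart e K k u : u \is e.-homog -> hpart c K k u \is (e - k).-homog.
Proof.
move=> hu; apply: rpred_sum => m /andP[/eqP mk _]; apply: dhomogZ.
by have := homog_mderivm m hu; rewrite mk.
Qed.

Lemma hpart_eq0 e K k u : u \is e.-homog -> (e < k)%N -> hpart c K k u = 0.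
Proof.
move=> hu ek; apply: big1 => m /andP[/eqP mk _].
by rewrite (homog_mderivm0 hu) ?mk // scaler0.
Qed.

(** The monomials are split according to whether [a] occurs in them; those in which it occurs are
    [U_(a)] times a monomial of degree [k]. *)
Lemma hpartS K a k u : a \in K ->
  hpart c K k.+1 u = hpart c (K :\ a) k.+1 u + (c a)^-1 *: hpart c K k u^`M(a).
Proof.
move=> aK; rewrite {1}/hpart (bigID (fun m : 'X_{1..N < k.+2} => m a == 0%N)) /=.
congr (_ + _).
  apply: eq_big => [m|m /andP[_ /eqP ma]].
    rewrite -andbA; congr (_ && _); apply/andP/forallP => [[/forallP h ma] i|h].
      rewrite !inE negb_and negbK; apply/implyP => /orP[/eqP -> //|iK].
      by have := h i; rewrite iK.
    split; last by have := h a; rewrite !inE eqxx.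
    apply/forallP => i; apply/implyP => iK; have := h i.
    by rewrite !inE (negbTE iK) andbF.
  by rewrite (big_setD1 a) //= ma expr0 invr1 mul1r.
(* Mutually inverse shifts by [U_(a)] on the relevant monomials; the default [bm0] of [insubd] is
   never reached there. *)
pose h1 (m : 'X_{1..N < k.+1}) : 'X_{1..N < k.+2} := insubd bm0 (m + U_(a))%MM.
pose h2 (m : 'X_{1..N < k.+2}) : 'X_{1..N < k.+1} := insubd bm0 (m - U_(a))%MM.
have h1E (m : 'X_{1..N < k.+1}) : h1 m = (m + U_(a))%MM :> 'X_{1..N}.
  rewrite insubdK // unfold_in mdegD mdeg1 addn1.
  by rewrite ltnS bmdeg.
rewrite (reindex_onto h1 h2) => [|m /andP[/andP[/eqP mk _] ma]] /=; last first.
  apply: val_inj; rewrite /= h1E /h2 insubdK ?submK ?lep1mP //.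
  have : mdeg (m - U_(a) + U_(a))%MM = k.+1 by rewrite submK ?lep1mP.
  by rewrite unfold_in mdegD mdeg1 addn1 => -[->].
rewrite /hpart scaler_sumr; apply: eq_big => [m|m /andP[/andP[/andP[_ _] _] _]].
  have -> : h2 (h1 m) == m.
    apply/eqP/val_inj; rewrite /= /h2 h1E addmK insubdK // unfold_in; exact: bmdeg.
  rewrite !h1E mdegD mdeg1 addn1 eqSS mnmDE mnm1E eqxx addn1 /= !andbT.
  congr (_ && _); apply: eq_forallb => i; rewrite mnmDE mnm1E.
  have [//|iK] := boolP (i \in K); case: (a =P i) => [ai|_]; last by rewrite addn0.
  by rewrite -ai aK in iK.
rewrite h1E scalerA; congr (_ *: _).
  rewrite (big_setD1 a) //= [in RHS](big_setD1 a) //= [RHS]mulrA; congr (_ * _).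
    by rewrite mnmDE mnm1E eqxx addn1 exprS invfM.
  apply: eq_bigr => i; rewrite !inE mnmDE mnm1E (eq_sym a) => /andP[/negbTE -> _].
  by rewrite addn0.
by rewrite addmC mderivmDm mderivmU1m.
Qed.

Lemma hpart_set0 k u : hpart c set0 k.+1 u = 0.
Proof.
rewrite /hpart big1 // => m /andP[/eqP mk /forallP h].
have : mdeg m = 0%N.
  by rewrite mdegE big1 // => i _; have := h i; rewrite inE => /eqP.
by rewrite mk.
Qed.

End Hpart.

(** * The correction term of the subdivision and its derivatives *)

Section Subdivision.
Variables (R : realType) (N : nat) (c : 'I_N -> R) (t0 : 'I_N) (S : {set 'I_N}).
Hypotheses (t0S : t0 \notin S) (c0 : forall i, i \in S -> 0 < c i).
Implicit Types (f g u h : {mpoly R[N]}) (K T A : {set 'I_N}) (x : 'rV[R]_N).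

Definition wall : {mpoly R[N]} := 'X_t0 - \sum_(i in S) c i *: 'X_i.

Definition divpow n : {mpoly R[N]} := n`!%:R^-1 *: wall ^+ n.

(* The sum over n in sub_S(f) is the case K = S, j = #|S|, m = n - #|S|.  The
   family is stable under differentiation: since
   h_m(K) = h_m(K - a) + \bar\partial_a h_(m-1)(K) for a in K, a derivative in
   direction a removes a from K and lowers j. *)
Definition blowup K j M u : {mpoly R[N]} :=
  \sum_(m < M) divpow (m + j) * hpart c K m u.

Lemma mderiv_var i j : ('X_j : {mpoly R[N]})^`M(i) = (j == i)%:R%:MP.
Proof.
rewrite mderivX mnm1E; case: eqP => [->|_]; last by rewrite scale0r mpolyC0.
rewrite scale1r; have -> : (U_(i) - U_(i))%MM = 0%MM :> 'X_{1..N}.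
  by apply/mnmP => k; rewrite mnmBE subnn mnm0E.
by rewrite mpolyX0 mpolyC1.
Qed.

Lemma wall_mderiv i :
  wall^`M(i) = ((t0 == i)%:R - (if i \in S then c i else 0))%:MP.
Proof.
rewrite /wall mderivB mderiv_var mderiv_sum rmorphB /=; congr (_ - _).
case: ifPn => iS.
  rewrite (bigD1 i) //= mderivZ mderiv_var eqxx mpolyC1 alg_mpolyC big1 ?addr0 //.
  by move=> j /andP[_ /negbTE ji]; rewrite mderivZ mderiv_var ji mpolyC0 scaler0.
rewrite big1 ?mpolyC0 // => j jS; rewrite mderivZ mderiv_var.
case: eqP => [ji|_]; last by rewrite mpolyC0 scaler0.
by rewrite -ji jS in iS.
Qed.

Lemma mderiv_exp i h n : (h ^+ n.+1)^`M(i) = n.+1%:R *: (h^`M(i) * h ^+ n).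
Proof.
elim: n => [|n ih]; first by rewrite expr1 expr0 mulr1 scale1r.
rewrite exprS mderivM ih -scalerAr mulrCA -exprS -[X in X + _]scale1r -scalerDl.
by rewrite -natr1 addrC -[n.+2%:R]natr1 natr1.
Qed.

Lemma divpow_mderiv i n : (divpow n.+1)^`M(i) = wall^`M(i) * divpow n.
Proof.
rewrite /divpow mderivZ mderiv_exp scalerA -scalerAr; congr (_ *: _).
rewrite factS natrM invfM mulrC mulrA divff ?mul1r //.
by rewrite pnatr_eq0.
Qed.

Lemma blowup_is_linear K j M : linear (blowup K j M).
Proof.
move=> a f g; rewrite /blowup scaler_sumr -big_split; apply: eq_bigr => m _ /=.
by rewrite linearP /= mulrDr scalerAr.
Qed.
HB.instance Definition _ K j M :=
  GRing.isLinear.Build R {mpoly R[N]} {mpoly R[N]} _ (blowup K j M)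
    (blowup_is_linear K j M).

Lemma blowup_trunc K j M e u : u \is e.-homog -> (e < M)%N ->
  blowup K j M u = blowup K j e.+1 u.
Proof.
move=> hu eM; rewrite /blowup.
rewrite [RHS](big_ord_widen _ (fun m => divpow (m + j) * hpart c K m u) eM).
rewrite [RHS]big_mkcond; apply: eq_bigr => m _; case: ifPn => //.
by rewrite -ltnNge => em; rewrite (hpart_eq0 _ _ hu) ?mulr0 // ltnW.
Qed.

Lemma blowup_mderiv_out K j M i u : i \notin S -> i != t0 ->
  (blowup K j M u)^`M(i) = blowup K j M u^`M(i).
Proof.
move=> iS it0; rewrite /blowup mderiv_sum; apply: eq_bigr => m _.
rewrite mderivM -hpart_mderiv; case: (m + j)%N => [|n].
  by rewrite /divpow expr0 alg_mpolyC mderivC mul0r add0r.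
by rewrite divpow_mderiv wall_mderiv (negbTE iS) eq_sym (negbTE it0) subr0
  mpolyC0 !mul0r add0r.
Qed.

Lemma blowup_mderiv_new K j M u : u^`M(t0) = 0 ->
  (blowup K j.+1 M u)^`M(t0) = blowup K j M u.
Proof.
move=> ut0; rewrite /blowup mderiv_sum; apply: eq_bigr => m _.
rewrite mderivM -hpart_mderiv ut0 raddf0 mulr0 addr0 addnS divpow_mderiv.
by rewrite wall_mderiv (negbTE t0S) eqxx subr0 mpolyC1 mul1r.
Qed.

(** The product rule gives two sums. After an index shift the second cancels, by [hpartS], the part
    of the first in which [a] occurs in h_m, leaving the sum for [K :\ a]. *)
Lemma blowup_mderiv_in K j M e a u : a \in K -> K \subset S ->
  u \is e.-homog -> (e < M)%N ->
  (blowup K j.+1 M u)^`M(a) = - c a *: blowup (K :\ a) j M u.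
Proof.
move=> aK /subsetP/(_ a aK) aS hu; case: M => // M eM.
have ca : c a != 0 by rewrite gt_eqF // c0.
have dw n : (divpow n.+1)^`M(a) = - c a *: divpow n.
  rewrite divpow_mderiv wall_mderiv aS; case: eqP => [ta|_].
    by move: t0S; rewrite ta aS.
  by rewrite add0r mul_mpolyC.
rewrite /blowup mderiv_sum scaler_sumr.
under eq_bigr => m _ do rewrite mderivM -hpart_mderiv addnS dw -scalerAl.
rewrite big_split /= big_ord_recl [X in _ + X]big_ord_recr /=.
(* The top term of the shifted sum: h_M of [u] has degree 0 because e <= M, so its derivative
   vanishes. *)
rewrite [X in _ + (_ + X)](_ : _ = 0) ?addr0; last first.
  rewrite hpart_mderiv (homog0_mderiv a) ?mulr0 //.
  by have := homog_hpart c K M hu; have -> : (e - M = 0)%N by move: eM; lia.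
rewrite -addrA -big_split big_ord_recl /= !hpart0; congr (_ + _).
apply: eq_bigr => m _ /=; rewrite /bump /= add1n (hpartS _ _ _ aK) addSn.
rewrite mulrDr scalerDr -addrA [X in _ + X](_ : _ = 0) ?addr0 //.
by rewrite -scalerAr scalerA mulNr divff // scaleN1r addNr.
Qed.

Lemma dpartZ A a h : dpart A (a *: h) = a *: dpart A h.
Proof. exact: mderivmZ. Qed.

Lemma blowup_dpart_in A K j M e u : A \subset K -> K \subset S ->
  u \is e.-homog -> (e < M)%N ->
  dpart A (blowup K (j + #|A|) M u) =
  (\prod_(i in A) - c i) *: blowup (K :\: A) j M u.
Proof.
have [n le_n] := ubnP #|A|; elim: n A K le_n => // n ih A K le_n AK KS hu eM.
have [->|[a aA]] := set_0Vmem A.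
  by rewrite dpart0 cards0 addn0 setD0 big_set0 scale1r.
have aK := subsetP AK a aA.
rewrite (big_setD1 a) //= (cardsD1 a A) aA add1n addnS.
rewrite -{1}(setD1K aA) setUC dpartU ?dpart1; last first.
  by rewrite disjoint_sym disjoints1 setD11.
rewrite (@blowup_mderiv_in K _ M e) // dpartZ ih //.
- rewrite scalerA; congr (_ *: blowup _ _ _ _).
  by apply/setP => i; rewrite !inE; case: eqP => [->|//]; rewrite aA.
- by move: le_n; rewrite (cardsD1 a A) aA.
- by apply: setSD.
- by apply: subset_trans KS; apply: subD1set.
Qed.

Lemma blowup_dpart_out A K j M u : [disjoint A & S] -> t0 \notin A ->
  dpart A (blowup K j M u) = blowup K j M (dpart A u).
Proof.
have [n le_n] := ubnP #|A|; elim: n A u le_n => // n ih A u le_n AS tA.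
have [->|[a aA]] := set_0Vmem A; first by rewrite !dpart0.
rewrite -(setD1K aA) !dpartU1 ?setD11 // ih.
- rewrite blowup_mderiv_out ?(disjointFr AS) //.
  by apply: contraNneq tA => <-.
- by move: le_n; rewrite (cardsD1 a A) aA.
- by apply: disjointWl AS; apply: subD1set.
- by rewrite !inE (negbTE tA) andbF.
Qed.

Lemma blowup0E M u : blowup set0 0 M.+1 u = u.
Proof.
rewrite /blowup big_ord_recl hpart0 /divpow expr0 invr1 scale1r mul1r big1 ?addr0 //.
by move=> m _; rewrite hpart_set0 mulr0.
Qed.

Lemma homog_wall : wall \is 1.-homog.
Proof.
have hX i : ('X_i : {mpoly R[N]}) \is 1.-homog by rewrite dhomogX; apply/eqP; exact: mdeg1.
by rewrite /wall rpredB // rpred_sum // => i _; apply: dhomogZ.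
Qed.

Lemma homog_blowup K j M e u : u \is e.-homog -> (e < M)%N ->
  blowup K j M u \is (e + j).-homog.
Proof.
move=> hu eM; rewrite (blowup_trunc _ _ hu eM); apply: rpred_sum => m _.
have -> : (e + j = (m + j) + (e - m))%N by have := ltn_ord m; lia.
apply: dhomogM; last exact: homog_hpart.
apply: dhomogZ; have := dhomogMn (m + j) homog_wall; rewrite mul1n; exact.
Qed.

(* Substituting the hyperplane equation for [t0] kills [wall], hence recovers
   the derivatives of [f] from those of its subdivision. *)
Definition on_wall h : {mpoly R[N]} :=
  h \mPo [tuple (if i == t0 then \sum_(j in S) c j *: 'X_j else 'X_i) | i < N].

Lemma on_wall_is_linear : linear on_wall.
Proof. by move=> a f g; rewrite /on_wall linearP. Qed.
HB.instance Definition _ :=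
  GRing.isLinear.Build R {mpoly R[N]} {mpoly R[N]} _ on_wall on_wall_is_linear.

Lemma on_wall_sum (I : Type) (r : seq I) (P : pred I) (F : I -> {mpoly R[N]}) :
  on_wall (\sum_(i <- r | P i) F i) = \sum_(i <- r | P i) on_wall (F i).
Proof. exact: linear_sum. Qed.

Lemma on_wallX i : on_wall 'X_i = if i == t0 then \sum_(j in S) c j *: 'X_j else 'X_i.
Proof. by rewrite /on_wall comp_mpolyXU (nth_map i) ?size_enum_ord // nth_ord_enum. Qed.

Lemma on_wall_wall : on_wall wall = 0.
Proof.
rewrite /wall linearB /= on_wallX eqxx on_wall_sum.
apply/eqP; rewrite subr_eq0; apply/eqP; apply: eq_bigr => i iS.
rewrite [in RHS]linearZ /= on_wallX; case: eqP => // it.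
by move: t0S; rewrite -it iS.
Qed.

Lemma on_wallM f g : on_wall (f * g) = on_wall f * on_wall g.
Proof. exact: rmorphM. Qed.

Lemma on_wall_id h : h^`M(t0) = 0 -> on_wall h = h.
Proof.
move=> /mderiv_poly_in ht; rewrite /on_wall comp_mpolyE [RHS]mpolyE !big_seq.
apply: eq_bigr => m hm; congr (_ *: _); rewrite mpolyXE_id; apply: eq_bigr => i _.
rewrite tnth_mktuple; case: eqP => // ->.
by rewrite ht // !expr0.
Qed.

Lemma on_wall_divpow n : on_wall (divpow n.+1) = 0.
Proof.
rewrite /divpow linearZ /= exprS on_wallM on_wall_wall mul0r scaler0 //.
Qed.

Lemma on_wall_blowupS K j M u : on_wall (blowup K j.+1 M u) = 0.
Proof.
rewrite /blowup on_wall_sum big1 // => m _.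
by rewrite on_wallM addnS on_wall_divpow mul0r.
Qed.

Lemma on_wall_blowup0 K M u : u^`M(t0) = 0 -> on_wall (blowup K 0 M.+1 u) = u.
Proof.
move=> ut; rewrite /blowup big_ord_recl [LHS]linearD /=.
rewrite hpart0 /divpow expr0 invr1 scale1r mul1r on_wall_id //.
rewrite on_wall_sum big1 ?addr0 // => m _.
by rewrite on_wallM /= on_wall_divpow mul0r.
Qed.

Lemma on_wallC a : on_wall a%:MP = a%:MP.
Proof. exact: comp_mpolyC. Qed.

Definition to_wall x : 'rV[R]_N :=
  \row_i (if i == t0 then \sum_(j in S) c j * x 0 j else x 0 i).

Lemma to_wall_linear a x y : to_wall (a *: x + y) = a *: to_wall x + to_wall y.
Proof.
apply/rowP => i; rewrite !mxE; case: ifP => // _.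
by rewrite mulr_sumr -big_split; apply: eq_bigr => j _ /=; rewrite !mxE; ring.
Qed.

Lemma meval_on_wall h x : (on_wall h).@[x 0] = h.@[to_wall x 0].
Proof.
rewrite /on_wall comp_mpoly_meval; apply: meval_eq => i.
rewrite tnth_mktuple mxE; case: ifP => _; last by rewrite mevalXU.
by rewrite meval_sum; apply: eq_bigr => j _; rewrite mevalZ mevalXU.
Qed.

End Subdivision.

(** * Faces and face derivatives of the subdivided polynomial *)

Section SubdivisionLinks.
Variables (R : realType) (N : nat) (c : 'I_N -> R) (t0 : 'I_N) (S : {set 'I_N}).
Variables (f : {mpoly R[N]}) (d : nat).
Hypotheses (t0S : t0 \notin S) (c0 : forall i, i \in S -> 0 < c i).
Hypotheses (hf : f \is d.-homog) (ft0 : f^`M(t0) = 0) (SD : S \in Delta f).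
Hypothesis (S0 : (0 < #|S|)%N).
Implicit Types (T F : {set 'I_N}) (x : 'rV[R]_N).

Local Notation g := (subdivision t0 c S f).
Local Notation M := (d.+1 - #|S|)%N.
Local Notation bl T j := (blowup c t0 S (S :\: T) j M (dpart (S :|: T) f)).

(** What remains of the scaling in \bar\partial^S once each derivative in a direction i of both [T]
    and [S] has contributed c_i up to sign. *)
Definition link_coef T : R := \prod_(i in S :\: T) (c i)^-1.

Lemma link_coef_gt0 T : 0 < link_coef T.
Proof. by apply: prodr_gt0 => i; rewrite inE invr_gt0 => /andP[_ /c0]. Qed.

Lemma link_coef1 T a : S :\: T = [set a] -> link_coef T = (c a)^-1.
Proof. by move=> ST; rewrite /link_coef ST big_set1. Qed.

Lemma dpart_t0 T : (dpart T f)^`M(t0) = 0.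
Proof. by rewrite /dpart mderivmi_comm ft0 raddf0. Qed.

Lemma cardS_le : (#|S| <= d)%N.
Proof. exact: card_Delta hf SD. Qed.

Lemma subdivisionE :
  g = f - (-1) ^+ #|S| *: blowup c t0 S S #|S| M (link_coef set0 *: dpart S f).
Proof.
have f0 : f != 0.
  by apply: contraTneq SD => f0; rewrite f0 !inE /dpart raddf0 eqxx.
rewrite /subdivision (homog_degree hf f0) -/(wall c t0 S); congr (_ - _).
rewrite -[in LHS]signr_odd -[in RHS]signr_odd mulr_sign scaler_sign.
have -> : \sum_(#|S| <= n < d.+1)
     n`!%:R^-1 *: wall c t0 S ^+ n *
     hpart c S (n - #|S|) (\prod_(i in S) (c i)^-1 *: dpart S f) =
   blowup c t0 S S #|S| M (link_coef set0 *: dpart S f); last by [].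
rewrite -{1}[#|S|]add0n big_addn big_mkord /blowup; apply: eq_bigr => m _.
by rewrite addnK /link_coef setD0.
Qed.

Lemma homog_sub : g \is d.-homog.
Proof.
rewrite subdivisionE rpredB //; apply: dhomogZ.
rewrite -[X in X.-homog](subnK cardS_le); apply: homog_blowup => //.
  by apply: dhomogZ; apply: homog_dpart.
by rewrite subSn ?cardS_le.
Qed.

Lemma dpart_homogM T : dpart (S :|: T) f \is (d - #|S :|: T|).-homog /\
  (d - #|S :|: T| < M)%N.
Proof.
split; first exact: homog_dpart.
rewrite subSn ?cardS_le // ltnS; apply: leq_sub2l; apply: subset_leq_card.
exact: subsetUl.
Qed.

(** Directions of [T] in [S] shrink the set of the correction term and lower its exponent of z, each
    with a sign; directions outside [S] pass through to [f]. The signs combine to that of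
    [#|S :\: T|]. *)
Lemma dpart_sub T : t0 \notin T ->
  dpart T g = dpart T f - ((-1) ^+ #|S :\: T| * link_coef T) *: bl T #|S :\: T|.
Proof.
move=> tT; rewrite subdivisionE {1}/dpart mderivmB mderivmZ -!/(dpart _ _).
congr (_ - _).
have dTS : [disjoint T :\: S & S].
  by rewrite disjoints_subset; apply/subsetP => i; rewrite !inE => /andP[].
have -> : dpart T (blowup c t0 S S #|S| M (link_coef set0 *: dpart S f)) =
  ((-1) ^+ #|T :&: S| * \prod_(i in T :&: S) c i * link_coef set0) *: bl T #|S :\: T|.
  rewrite -{1}(setID T S) dpartU; last first.
    rewrite disjoints_subset; apply/subsetP => i; rewrite !inE => /andP[_ ->] //.
  rewrite blowup_dpart_out //; last by rewrite !inE (negbTE tT) andbF.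
  have {1}-> : #|S| = (#|S :\: T| + #|T :&: S|)%N by rewrite setIC addnC cardsID.
  rewrite (@blowup_dpart_in _ _ c t0 S t0S c0 _ _ _ _ (d - #|S| - #|T :\: S|)%N).
  - have -> : S :\: T :&: S = S :\: T.
      by apply/setP => i; rewrite !inE; case: (i \in S); rewrite ?andbT ?andbF.
    rewrite dpartZ [X in _ *: X]linearZ /= -dpartU // scalerA prodrN.
    congr (_ *: blowup _ _ _ _ _ _ (dpart _ _)).
    by apply/setP => i; rewrite !inE; case: (i \in S); rewrite ?orbT //= orbF.
  - exact: subsetIr.
  - exact: subxx.
  - by apply: homog_dpart; apply: dhomogZ; apply: homog_dpart.
  - by rewrite subSn ?cardS_le // ltnS leq_subr.
rewrite scalerA; congr (_ *: _).
have -> : #|S| = (#|S :\: T| + #|T :&: S|)%N by rewrite setIC addnC cardsID.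
have -> : link_coef set0 = \prod_(i in T :&: S) (c i)^-1 * link_coef T.
  by rewrite /link_coef setD0 (big_setID T) /= setIC.
rewrite exprD.
have h1 : \prod_(i in T :&: S) c i * \prod_(i in T :&: S) (c i)^-1 = 1.
  rewrite -big_split big1 //= => i; rewrite inE => /andP[_ iS].
  by rewrite mulfV // gt_eqF // c0.
have h2 : (-1) ^+ #|T :&: S| * (-1) ^+ #|T :&: S| = 1 :> R.
  by rewrite -expr2 sqrr_sign.
set a := _ ^+ #|T :&: S| in h2 *; set p := \prod_(i in _) _ in h1 *.
set q := \prod_(i in _) _ in h1 *.
by rewrite -[RHS]mul1r -h2 -[RHS]mul1r -h1; ring.
Qed.

Lemma dpart_sub_new T : t0 \notin T -> ~~ (S \subset T) ->
  dpart (t0 |: T) g =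
    - ((-1) ^+ #|S :\: T| * link_coef T) *: bl T #|S :\: T|.-1.
Proof.
move=> tT ST; rewrite dpartU1 // dpart_sub // mderivB mderivZ dpart_t0 sub0r scaleNr.
have : (0 < #|S :\: T|)%N by rewrite lt0n cards_eq0 setD_eq0.
by case: #|S :\: T| => // k _; rewrite blowup_mderiv_new // dpart_t0.
Qed.

(** Differentiating along all of [S] reduces the correction to its term z^0 h_0, which is \partial^S
    f itself: the two cancel, and [S] ceases to be a face. *)
Lemma dpart_sub0 T : S \subset T -> dpart T g = 0.
Proof.
move=> ST; apply: (dpartS0 ST); rewrite dpart_sub // /link_coef setDv cards0 big_set0.
by rewrite mulr1 setUid scale1r subSn ?cardS_le // blowup0E subrr.
Qed.

Lemma on_wall_sub T : t0 \notin T -> ~~ (S \subset T) ->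
  on_wall c t0 S (dpart T g) = dpart T f.
Proof.
move=> tT ST; rewrite dpart_sub // [LHS]linearB /= [X in _ - X]linearZ /=.
have : (0 < #|S :\: T|)%N by rewrite lt0n cards_eq0 setD_eq0.
case: #|S :\: T| => // k _.
by rewrite on_wall_blowupS // scaler0 subr0 on_wall_id // dpart_t0.
Qed.

(** With one vertex [a] of [S] missing from [T], the derivative by t0 leaves a term free of z, the
    only one to survive on the wall. It returns the derivatives of [f] along faces containing [S],
    which the subdivision removes. *)
Lemma on_wall_sub_new T a : a \in S -> a \notin T -> S :\ a \subset T -> t0 \notin T ->
  on_wall c t0 S (dpart (t0 |: T) g) = (c a)^-1 *: dpart (a |: T) f.
Proof.
move=> aS aT SaT tT.
have STa : S :\: T = [set a].
  apply/setP => i; rewrite !inE; case: eqP => [->|/eqP ia]; first by rewrite aT aS.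
  apply/negP => /andP[iT iS]; have := subsetP SaT i.
  by rewrite !inE ia iS (negbTE iT) => /(_ isT).
have SaTU : S :|: T = a |: T.
  apply/setP => i; rewrite !inE; have [iT|iT] := boolP (i \in T); rewrite ?orbT ?orbF //.
  by move/setP/(_ i): STa; rewrite !inE iT.
rewrite dpart_sub_new //; last by apply: contra aT => /subsetP; apply.
rewrite STa cards1 /= expr1 mulN1r opprK (link_coef1 STa) [LHS]linearZ /=.
by rewrite subSn ?cardS_le // on_wall_blowup0 ?SaTU // dpart_t0.
Qed.

Lemma Delta_sub T : t0 \notin T ->
  (T \in Delta g) = (T \in Delta f) && ~~ (S \subset T).
Proof.
move=> tT; have [ST|ST] := boolP (S \subset T); rewrite ?andbF ?andbT.
  by rewrite inE dpart_sub0 ?eqxx.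
apply/idP/idP; rewrite !inE; apply: contra_neq => fT.
  rewrite dpart_sub // fT (dpartS0 _ fT) ?subsetUr //.
  by rewrite [X in _ *: X]linear0 scaler0 subr0.
by rewrite -on_wall_sub // fT [LHS]linear0.
Qed.

Lemma Delta_sub_new T : t0 \notin T ->
  (t0 |: T \in Delta g) = (S :|: T \in Delta f) && ~~ (S \subset T).
Proof.
move=> tT; have [ST|ST] := boolP (S \subset T); rewrite ?andbF ?andbT.
  by rewrite inE dpart_sub0 ?eqxx // (subset_trans ST) // subsetU1.
apply/idP/idP; first rewrite !inE.
  by apply: contra_neq => fT; rewrite dpart_sub_new // fT [X in _ *: X]linear0 scaler0.
(* Enlarging [T] to the join minus a single [a] of [S] reaches the situation of
   [on_wall_sub_new]. *)
have [a aS aT] := subsetPn ST; pose T2 := (S :|: T) :\ a => STD.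
have tT2 : t0 \notin T2 by rewrite !inE negb_and negb_or t0S tT orbT.
apply: (@DeltaS _ _ _ _ (t0 |: T2)).
  apply/subsetP => i; rewrite !inE => /orP[->//|iT]; rewrite iT orbT andbT.
  by apply/orP; right; apply: contraNneq aT => <-.
have STa : a |: T2 = S :|: T by rewrite setD1K // inE aS.
rewrite inE; apply: contraTneq STD => h; rewrite inE negbK.
have aT2 : a \notin T2 by rewrite setD11.
have := on_wall_sub_new aS aT2 (setSD _ (subsetUl _ _)) tT2.
rewrite h [LHS]linear0 STa => /esym/eqP.
by rewrite scaler_eq0 invr_eq0 gt_eqF ?c0.
Qed.

End SubdivisionLinks.

Section HyperbolicForms.
Variables (R : realType) (N : nat).
Implicit Types (q : 'rV[R]_N -> R) (x : 'rV[R]_N) (h : {mpoly R[N]}).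

Lemma hyperbolicZ a q : 0 <= a -> hyperbolic q -> hyperbolic (fun x => a * q x).
Proof.
move=> a0 [c [l [c0 hl hq]]]; exists (a * c), l; split => // [|x].
  by rewrite mulr_ge0.
by rewrite -mulrA; apply: ler_wpM2l.
Qed.

Lemma hyperbolic_le q q' : (forall x, q' x <= q x) -> hyperbolic q -> hyperbolic q'.
Proof.
move=> qq [c [l [c0 hl hq]]]; exists c, l; split => // x.
exact: le_trans (qq x) (hq x).
Qed.

Lemma hyperbolicM (l l' : 'rV[R]_N -> R) : is_lin l -> is_lin l' ->
  hyperbolic (fun x => l x * l' x).
Proof.
move=> hl hl'; exists 4^-1, (fun x => l x + l' x); split => [|a x y|x].
- by rewrite invr_ge0.
- by rewrite hl hl'; ring.
by have := sqr_ge0 (l x - l' x); nra.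
Qed.

Lemma meval_lin h : h \is 1.-homog -> is_lin (fun x => h.@[x 0]).
Proof.
move=> hh a x y; rewrite !meval_homog1 // DdirD DdirZ.
by rewrite mcoeffD mcoeffZ.
Qed.

Lemma Ddir_delta a h : Ddir (delta_mx 0 a) h = h^`M(a).
Proof.
rewrite /Ddir (bigD1 a) //= mxE !eqxx scale1r big1 ?addr0 // => i ia.
by rewrite mxE (negbTE ia) andbF scale0r.
Qed.

Lemma taylor2 h x a s : h \is 2.-homog ->
  h.@[(x + s *: delta_mx 0 a : 'rV[R]_N) 0] =
  h.@[x 0] + s * h^`M(a).@[x 0] + s ^+ 2 / 2 * (h^`M(a)^`M(a))@_0%MM.
Proof.
move=> hh; rewrite 2!(meval_homog2 _ hh) bil_sqr ?form_mx_sym //.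
rewrite meval_homog1 ?(homog_mderiv _ hh) //.
by rewrite !bil_form !Ddir_delta; field.
Qed.

End HyperbolicForms.

(** * Signs and quadratic derivatives under subdivision, in both directions *)

Section SubdivisionLocal.
Variables (R : realType) (N : nat) (c : 'I_N -> R) (t0 : 'I_N) (S : {set 'I_N}).
Variables (f : {mpoly R[N]}) (d : nat).
Hypotheses (t0S : t0 \notin S) (c0 : forall i, i \in S -> 0 < c i).
Hypotheses (hf : f \is d.-homog) (ft0 : f^`M(t0) = 0) (SD : S \in Delta f).
Hypothesis (S0 : (0 < #|S|)%N).
Implicit Types (T F : {set 'I_N}) (x : 'rV[R]_N).

Local Notation g := (subdivision t0 c S f).

Lemma card_join T : #|S :|: T| = (#|T| + #|S :\: T|)%N.
Proof.
have -> : S :|: T = T :|: (S :\: T).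
  by apply/setP => i; rewrite !inE; case: (i \in T); rewrite ?orbT ?orbF.
apply/eqP; rewrite (leq_card_setU _ _).2 disjoint_sym disjoints_subset.
by apply/subsetP => i; rewrite !inE => /andP[].
Qed.

Lemma join_large T : (d < #|T| + #|S :\: T|)%N -> dpart (S :|: T) f = 0.
Proof.
by move=> dT; rewrite /dpart (homog_mderivm0 hf) // mdeg_mesym1 card_join.
Qed.

Lemma on_wall_homog0 h : h \is 0.-homog -> on_wall c t0 S h = h.
Proof. by move=> /homog0C ->; rewrite on_wallC. Qed.

Lemma remove_apex F : t0 \in F -> exists2 T : {set 'I_N}, t0 \notin T & F = t0 |: T.
Proof. by move=> tF; exists (F :\ t0); rewrite ?setD1K // setD11. Qed.

Lemma nonneg_facets_sub : nonneg_facets d f -> nonneg_facets d g.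
Proof.
move=> pos F Fd; have g0 : dpart F g \is 0.-homog.
  by have := homog_dpart F (homog_sub c t0S hf SD); rewrite Fd subnn.
have [/remove_apex[T tT FE]|tF] := boolP (t0 \in F); last first.
  have [SF|SF] := boolP (S \subset F).
    by rewrite (dpart_sub0 t0S c0 hf SD) // mcoeff0.
  by rewrite -(on_wall_homog0 g0) (on_wall_sub t0S c0 hf ft0 SD) // pos.
have [ST|ST] := boolP (S \subset T).
  rewrite (dpart_sub0 t0S c0 hf SD) ?mcoeff0 // FE.
  by apply: subset_trans ST (subsetU1 _ _).
have Td : d = #|T|.+1 by rewrite -Fd FE cardsU1 tT.
(* As [T] has d - 1 elements, either the join with [S] is too large to be a face, or [S] exceeds [T]
   by exactly one vertex and [on_wall_sub_new] gives the coefficient. *)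
have := ltnP d (#|T| + #|S :\: T|); case=> [lt|le].
  rewrite FE (dpart_sub_new t0S c0 hf ft0 SD) // join_large // [X in _ *: X]linear0.
  by rewrite scaler0 mcoeff0.
have /cards1P[a STa] : #|S :\: T| == 1%N.
  by rewrite eqn_leq lt0n cards_eq0 setD_eq0 ST andbT -(leq_add2l #|T|) addn1 -Td.
have : a \in S :\: T by rewrite STa set11.
rewrite inE => /andP[aT aS].
have SaT : S :\ a \subset T.
  apply/subsetP => i; rewrite !inE => /andP[ia iS]; apply: contraNT ia => iT.
  by rewrite -in_set1 -STa !inE iT.
rewrite -(on_wall_homog0 g0) FE (on_wall_sub_new t0S c0 hf ft0 SD aS) //.
by rewrite mcoeffZ mulr_ge0 ?invr_ge0 ?(ltW (c0 _)) // pos // cardsU1 aT add1n -Td.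
Qed.

(** A facet not containing [S] keeps its coefficient. One containing [S] is replaced in the
    subdivision, and its coefficient is c_a times that of the facet in which t0 takes the place of a
    vertex [a] of [S]. *)
Lemma nonneg_facets_unsub : nonneg_facets d g -> nonneg_facets d f.
Proof.
move=> pos F Fd; have g0 (T : {set 'I_N}) : #|T| = d -> dpart T g \is 0.-homog.
  by move=> Td; have := homog_dpart T (homog_sub c t0S hf SD); rewrite Td subnn.
have [tF|tF] := boolP (t0 \in F).
  by rewrite -(setD1K tF) dpartU1 ?setD11 // dpart_t0 // mcoeff0.
have [SF|SF] := boolP (S \subset F); last first.
  by rewrite -(on_wall_sub t0S c0 hf ft0 SD) // on_wall_homog0 ?g0 // pos.
have [a aS] : exists a, a \in S by apply/set0Pn; rewrite -cards_eq0 -lt0n.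
have aF := subsetP SF a aS; pose T := F :\ a.
have aT : a \notin T by rewrite setD11.
have tT : t0 \notin T by rewrite !inE (negbTE tF) andbF.
have FE : F = a |: T by rewrite setD1K.
have TD : #|t0 |: T| = d by rewrite -Fd FE !cardsU1 aT tT.
have := on_wall_sub_new t0S c0 hf ft0 SD aS aT (setSD _ SF) tT.
rewrite on_wall_homog0 ?g0 // => e.
have := pos _ TD; rewrite e mcoeffZ -FE pmulr_rge0 // invr_gt0 c0 //.
Qed.

Lemma hyperbolic_links_unsub : hyperbolic_links d g -> hyperbolic_links d f.
Proof.
move=> hyp T Td; have [tT|tT] := boolP (t0 \in T).
  apply: eq_hyperbolic (hyperbolic0 R N) => x.
  by rewrite -(setD1K tT) dpartU1 ?setD11 // dpart_t0 // meval0.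
have [ST|ST] := boolP (S \subset T); last first.
  have := hyperbolic_comp (to_wall_linear c t0 S) (hyp T Td).
  by apply: eq_hyperbolic => x; rewrite -meval_on_wall (on_wall_sub t0S c0 hf ft0 SD).
have [a aS] : exists a, a \in S by apply/set0Pn; rewrite -cards_eq0 -lt0n.
have aF := subsetP ST a aS; pose T' := T :\ a.
have aT : a \notin T' by rewrite setD11.
have tT' : t0 \notin T' by rewrite !inE (negbTE tT) andbF.
have FE : T = a |: T' by rewrite setD1K.
have TD : #|t0 |: T'|.+2 = d by rewrite -Td FE !cardsU1 aT tT'.
have ca := c0 aS.
have := hyperbolicZ (ltW ca) (hyperbolic_comp (to_wall_linear c t0 S) (hyp _ TD)).
apply: eq_hyperbolic => x.
rewrite -meval_on_wall (on_wall_sub_new t0S c0 hf ft0 SD aS aT (setSD _ ST) tT').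
by rewrite mevalZ mulrA divff ?gt_eqF // mul1r -FE.
Qed.

Definition wallv x : R := x 0 t0 - \sum_(i in S) c i * x 0 i.

Lemma wallv_lin : is_lin wallv.
Proof.
move=> a x y; rewrite /wallv !mxE mulrBr addrACA -opprD; congr (_ - _).
rewrite mulr_sumr -big_split; apply: eq_bigr => i _ /=.
by rewrite !mxE; ring.
Qed.

Lemma meval_divpow n x : (divpow c t0 S n).@[x 0] = wallv x ^+ n / n`!%:R.
Proof.
rewrite /divpow mevalZ mulrC; congr (_ / _); rewrite rmorphXn /=; congr (_ ^+ _).
rewrite /wall mevalB mevalXU meval_sum; congr (_ - _); apply: eq_bigr => i _.
by rewrite mevalZ mevalXU.
Qed.

Lemma meval_blowup K j M e u x : u \is e.-homog -> (e < M)%N ->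
  (blowup c t0 S K j M u).@[x 0] =
  \sum_(m < e.+1) wallv x ^+ (m + j) / (m + j)`!%:R * (hpart c K m u).@[x 0].
Proof.
move=> hu eM; rewrite (blowup_trunc _ _ _ _ _ hu eM) /blowup meval_sum.
by apply: eq_bigr => m _; rewrite mevalM meval_divpow.
Qed.

Lemma hpart_single a k u : hpart c [set a] k u = (c a) ^- k *: u^`M[U_(a) *+ k].
Proof.
elim: k u => [|k ih] u; first by rewrite hpart0 expr0 invr1 scale1r mulm0n mderivm0m.
rewrite (hpartS _ _ _ (set11 a)) setDv hpart_set0 add0r ih scalerA.
by rewrite exprS invfM mderivSn.
Qed.

(* Along [S :\: T = [set a]] the subdivision only replaces t_a by t_a + z / c_a. *)
Definition slide a x : 'rV[R]_N := x + (wallv x / c a) *: delta_mx 0 a.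

Lemma slide_linear a b x y : slide a (b *: x + y) = b *: slide a x + slide a y.
Proof.
rewrite /slide wallv_lin scalerDr scalerA mulrDl scalerDl -!addrA; congr (_ + _).
by rewrite !addrA [X in X + _]addrC -!addrA mulrA.
Qed.

Lemma wedge1 T : #|S :\: T| = 1%N -> exists a, [/\ S :\: T = [set a], a \in S,
  a \notin T & S :|: T = a |: T].
Proof.
move/eqP/cards1P => [a STa]; exists a.
have : a \in S :\: T by rewrite STa set11.
rewrite inE => /andP[aT aS]; split => //.
apply/setP => i; rewrite !inE -in_set1 -STa inE.
by have [iT|iT] := boolP (i \in T); rewrite ?orbT ?orbF.
Qed.

(** Let k count the vertices of [S] outside the face. For a face t0 |: T the derivative of [f] in
    the correction has degree 3 - k: k = 1 gives 1/c_a times a quadratic derivative of [f] after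
    [slide], k = 2 gives z times a linear form, k = 3 gives a nonnegative multiple of z^2, and
    larger k gives 0. For an old face the degree is 2 - k: k = 1 is again [slide], k = 2 subtracts a
    nonnegative multiple of z^2, and larger k changes nothing. *)
Lemma hyperbolic_links_sub : nonneg_facets d f -> hyperbolic_links d f ->
  hyperbolic_links d g.
Proof.
move=> pos hyp F Fd.
have eM (T : {set 'I_N}) : (d - #|S :|: T| < d.+1 - #|S|)%N by case: (dpart_homogM hf SD T).
have hT (T : {set 'I_N}) e : (#|T| + #|S :\: T| + e)%N = d ->
  dpart (S :|: T) f \is e.-homog /\ (e < d.+1 - #|S|)%N.
  move=> Te; have := eM T; have := homog_dpart (S :|: T) hf.
  by rewrite card_join -Te addKn.
have [/remove_apex[T tT FE]|tF] := boolP (t0 \in F).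
  have Td : (#|T| + 3 = d)%N by rewrite -Fd FE cardsU1 tT addnC.
  have [ST|ST] := boolP (S \subset T).
    apply: eq_hyperbolic (hyperbolic0 R N) => x.
    rewrite (dpart_sub0 t0S c0 hf SD) ?meval0 // FE.
    by apply: subset_trans ST (subsetU1 _ _).
  have k0 : (0 < #|S :\: T|)%N by rewrite lt0n cards_eq0 setD_eq0.
  have l0 := link_coef_gt0 c0 T.
  have dE := dpart_sub_new t0S c0 hf ft0 SD tT ST.
  case k1 : (#|S :\: T| == 1%N).
    have [a [STa aS aT STE]] := wedge1 (eqP k1).
    have [|hu ue] := hT T 2; first by rewrite (eqP k1) -Td -addnA.
    rewrite STE in hu; have ca := c0 aS.
    have /hyp : #|a |: T|.+2 = d by rewrite cardsU1 aT -Td add1n addn3.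
    move/(hyperbolic_comp (slide_linear a)).
    have ci : 0 <= (c a)^-1 by rewrite invr_ge0 ltW.
    move/(hyperbolicZ ci); apply: eq_hyperbolic => x.
    rewrite FE dE (eqP k1) STa STE (link_coef1 c STa) expr1 mulN1r opprK mevalZ.
    congr (_ * _); rewrite (meval_blowup _ _ _ hu ue) !big_ord_recl big_ord0 /=.
    rewrite !hpart_single !mderivnS !mderivn0 /bump /= !add1n !addn0.
    rewrite taylor2 // !mevalZ.
    rewrite [(_ ^`M(a)^`M(a)).@[_]]meval_homog0; last first.
      by have := homog_mderiv a (homog_mderiv a hu).
    by rewrite !factS fact0 !expr0 !expr1; field; rewrite gt_eqF.
  case k2 : (#|S :\: T| == 2%N).
    have [|hu ue] := hT T 1%N; first by rewrite (eqP k2) -Td -addnA.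
    have hh : hpart c (S :\: T) 1 (dpart (S :|: T) f) \is 0.-homog.
      exact: (homog_hpart _ _ _ hu).
    have ll : is_lin (fun x => - link_coef c S T * ((dpart (S :|: T) f).@[x 0] +
        wallv x / 2 * (hpart c (S :\: T) 1 (dpart (S :|: T) f))@_0%MM)).
      by move=> a x y; rewrite (meval_lin hu) wallv_lin; ring.
    apply: eq_hyperbolic (hyperbolicM wallv_lin ll) => x.
    rewrite FE dE (eqP k2) expr2 mulrN1 opprK mul1r mevalZ.
    rewrite (meval_blowup _ _ _ hu ue) !big_ord_recl big_ord0 /=.
    rewrite hpart0 /bump /= !add1n !add0n (meval_homog0 _ hh).
    by rewrite !factS fact0 !expr1; field.
  case k3 : (#|S :\: T| == 3%N).
    have [|hu ue] := hT T 0%N; first by rewrite (eqP k3) -Td -addnA.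
    have u0 : 0 <= (dpart (S :|: T) f)@_0%MM.
      by apply: pos; rewrite card_join (eqP k3).
    have a0 : 0 <= link_coef c S T * 2^-1 * (dpart (S :|: T) f)@_0%MM.
      by rewrite mulr_ge0 // mulr_ge0 ?invr_ge0 ?ler0n // ltW.
    apply: eq_hyperbolic (hyperbolicZ a0 (hyperbolicM wallv_lin wallv_lin)) => x.
    rewrite FE dE (eqP k3) -signr_odd /= expr1 mulN1r opprK mevalZ.
    rewrite (meval_blowup _ _ _ hu ue) !big_ord_recl big_ord0 /=.
    rewrite hpart0 add0n (meval_homog0 _ hu).
    by rewrite !factS fact0; field.
  apply: eq_hyperbolic (hyperbolic0 R N) => x.
  rewrite FE dE join_large ?[X in _ *: X]linear0 ?scaler0 ?meval0 // -Td ltn_add2l.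
  by case: (#|S :\: T|) k0 k1 k2 k3 => [|[|[|[|]]]].
have [ST|ST] := boolP (S \subset F).
  by apply: eq_hyperbolic (hyperbolic0 R N) => x; rewrite (dpart_sub0 t0S c0 hf SD) ?meval0.
have k0 : (0 < #|S :\: F|)%N by rewrite lt0n cards_eq0 setD_eq0.
have l0 := link_coef_gt0 c0 F.
have dE := dpart_sub t0S c0 hf SD tF.
have Fd' : (#|F| + 2 = d)%N by rewrite addnC.
have hF : dpart F f \is 2.-homog by have := homog_dpart F hf; rewrite -Fd' addKn.
case k1 : (#|S :\: F| == 1%N).
  have [a [SFa aS aF SFE]] := wedge1 (eqP k1).
  have [|hu ue] := hT F 1%N; first by rewrite (eqP k1) -Fd' -addnA.
  have ca := c0 aS.
  move: (hyp F Fd) => /(hyperbolic_comp (slide_linear a)); apply: eq_hyperbolic => x.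
  rewrite dE (eqP k1) SFa (link_coef1 c SFa) expr1 mulN1r scaleNr opprK mevalD mevalZ.
  rewrite (meval_blowup _ _ _ hu ue) !big_ord_recl big_ord0 /=.
  rewrite !hpart_single !mderivnS !mderivn0 /bump /= !add1n.
  rewrite SFE dpartU1 // taylor2 // !mevalZ.
  rewrite [(_ ^`M(a)^`M(a)).@[_]]meval_homog0; last first.
    by have := homog_mderiv a (homog_mderiv a hF).
  by rewrite !factS fact0 !expr0 !expr1; field; rewrite gt_eqF.
case k2 : (#|S :\: F| == 2%N).
  have [|hu ue] := hT F 0%N; first by rewrite (eqP k2) -Fd' addn0.
  have u0 : 0 <= (dpart (S :|: F) f)@_0%MM.
    by apply: pos; rewrite card_join (eqP k2).
  apply: hyperbolic_le (hyp F Fd) => x.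
  rewrite dE (eqP k2) expr2 mulrN1 opprK mul1r mevalB gerBl mevalZ.
  rewrite (meval_blowup _ _ _ hu ue) !big_ord_recl big_ord0 /=.
  rewrite hpart0 add0n (meval_homog0 _ hu) addr0.
  apply: mulr_ge0; first exact: ltW.
  by apply: mulr_ge0 => //; apply: mulr_ge0; rewrite ?sqr_ge0 ?invr_ge0 ?ler0n.
apply: eq_hyperbolic (hyp F Fd) => x.
rewrite dE join_large ?[X in _ *: X]linear0 ?scaler0 ?subr0 // -Fd' ltn_add2l.
by case: (#|S :\: F|) k0 k1 k2 => [|[|[|]]].
Qed.

End SubdivisionLocal.

(** * Stars of the subdivided complex *)

Section SubdivisionStars.
Variables (R : realType) (N : nat) (c : 'I_N -> R) (t0 : 'I_N) (S : {set 'I_N}).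
Variables (f : {mpoly R[N]}) (d : nat).
Hypotheses (t0S : t0 \notin S) (c0 : forall i, i \in S -> 0 < c i).
Hypotheses (hf : f \is d.-homog) (ft0 : f^`M(t0) = 0) (SD : S \in Delta f).
Hypothesis (S0 : (0 < #|S|)%N).
Implicit Types (T F G : {set 'I_N}) (x : 'rV[R]_N).

Local Notation g := (subdivision t0 c S f).

(* The face of [Delta f] carrying the facet [F] of the subdivided complex. *)
Definition coarse F := if t0 \in F then S :|: (F :\ t0) else F.

Lemma coarse_sub F G : F \subset G -> coarse F \subset coarse G.
Proof.
move=> FG; rewrite /coarse; case: ifPn => [/(subsetP FG) ->|tF].
  by rewrite setUS // setSD.
case: ifP => // _; apply: subset_trans (subsetUr _ _).
by rewrite subsetD1 FG.
Qed.

Lemma facet_t0 F : F \in facets d f -> t0 \notin F.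
Proof.
rewrite !inE => /andP[Ff _]; apply: contraNN Ff => tF.
by rewrite -(setD1K tF) dpartU1 ?setD11 // dpart_t0.
Qed.

Lemma facet_old F : t0 \notin F ->
  (F \in facets d g) = (F \in facets d f) && ~~ (S \subset F).
Proof.
by move=> tF; rewrite inE (Delta_sub t0S c0 hf ft0 SD tF) [in RHS]inE andbAC.
Qed.

Lemma facet_new F i : F \in facets d f -> S \subset F -> i \in S ->
  t0 |: (F :\ i) \in facets d g.
Proof.
move=> Ff SF iS; have tF := facet_t0 Ff; have iF := subsetP SF i iS.
have tFi : t0 \notin F :\ i by rewrite !inE (negbTE tF) andbF.
rewrite inE (Delta_sub_new t0S c0 hf ft0 SD tFi) cardsU1 tFi.
have -> : S :|: (F :\ i) = F.
  apply/setP => j; rewrite !inE; have [->|_] := eqVneq j i; first by rewrite iS iF.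
  by have [/(subsetP SF)->|] := boolP (j \in S).
move: Ff; rewrite inE => /andP[-> /eqP <-] /=.
rewrite [in X in _ && X](cardsD1 i F) iF eqxx andbT.
by apply/subsetPn; exists i => //; rewrite setD11.
Qed.

Lemma coarse_new F i : F \in facets d f -> S \subset F -> i \in S ->
  coarse (t0 |: (F :\ i)) = F.
Proof.
move=> Ff SF iS; have tF := facet_t0 Ff.
rewrite /coarse setU11 setU1K; last by rewrite !inE (negbTE tF) andbF.
apply/setP => j; rewrite !inE; have [->|_] := eqVneq j i.
  by rewrite iS (subsetP SF).
by have [/(subsetP SF)->|] := boolP (j \in S).
Qed.

(** A face t0 |: T of size d forces the join of [S] and [T] to have d elements, hence exactly one
    vertex of [S] to be missing from [T]. *)
Lemma facet_apex F : F \in facets d g -> t0 \in F -> exists2 i,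
  i \in S :\: F & (coarse F \in facets d f) /\ F = t0 |: (coarse F :\ i).
Proof.
move=> Fg /[dup] tF /remove_apex[T tT FE]; move: Fg.
rewrite inE {1}FE (Delta_sub_new t0S c0 hf ft0 SD tT) => /andP[/andP[STD ST] /eqP Fd].
have Td : d = #|T|.+1 by rewrite -Fd FE cardsU1 tT.
have k1 : #|S :\: T| = 1%N.
  apply/eqP; rewrite eqn_leq lt0n cards_eq0 setD_eq0 ST andbT.
  by rewrite -(leq_add2l #|T|) addn1 -Td -card_join (card_Delta hf STD).
have [i [STi iS iT STE]] := wedge1 k1.
have cE : coarse F = S :|: T by rewrite /coarse tF FE setU1K.
exists i.
  rewrite inE iS FE !inE negb_or iT !andbT.
  by apply: contraNneq t0S => <-.
rewrite cE; split; first by rewrite inE STD card_join k1 addn1 -Td /=.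
by rewrite STE setU1K.
Qed.

Lemma facet_coarse F : F \in facets d g -> coarse F \in facets d f.
Proof.
move=> Fg; have [/(facet_apex Fg)[i _ []] //|tF] := boolP (t0 \in F).
by rewrite /coarse (negbTE tF); move: Fg; rewrite facet_old // => /andP[].
Qed.

Lemma facet_not_sub F : F \in facets d g -> ~~ (S \subset F).
Proof.
move=> Fg; have [/(facet_apex Fg)[i iSF _]|tF] := boolP (t0 \in F).
  by apply/subsetPn; exists i; move: iSF; rewrite inE => /andP[].
by move: Fg; rewrite facet_old // => /andP[].
Qed.

(** If t0 is not common to both, [coarse] only enlarges the intersection. Otherwise dropping t0
    costs one vertex, and joining [S] wins at least one back because neither facet contains [S]. *)
Lemma coarse_adjacent F G : F \in facets d g -> G \in facets d g ->
  (d <= #|F :&: G|.+1)%N -> (d <= #|coarse F :&: coarse G|.+1)%N.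
Proof.
move=> Fg Gg; case tFG : (t0 \in F :&: G); last first.
  move=> h; apply: leq_trans h _; rewrite ltnS; apply: subset_leq_card.
  suff h H K : t0 \notin H :&: K -> H :&: K \subset coarse H.
    by rewrite subsetI h ?tFG // setIC h // setIC tFG.
  rewrite /coarse inE negb_and; case: ifP => // tH tK; last exact: subsetIl.
  apply/subsetP => i; rewrite !inE => /andP[iH iK]; rewrite iH andbT.
  by apply/orP; right; apply: contraNneq tK => <-.
rewrite (cardsD1 t0) tFG add1n; move/leq_trans; apply; rewrite ltnS.
move: tFG; rewrite inE => /andP[tF tG].
apply: (@leq_trans #|S :|: ((F :&: G) :\ t0)|); last first.
  apply: subset_leq_card; rewrite /coarse tF tG subsetI.
  by rewrite !setUS // setSD // (subsetIl, subsetIr).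
rewrite card_join -addn1 leq_add2l lt0n cards_eq0 setD_eq0.
apply: contra (facet_not_sub Fg) => /subset_trans; apply.
by apply: subset_trans (subsetDl _ _) (subsetIl _ _).
Qed.

(** A colouring is pulled back along [coarse]. This needs a set T' whose star is carried onto that
    of [T]: [T] itself if it does not contain [S], otherwise [T] with one vertex of [S] replaced by
    t0. *)
Lemma connected_stars_unsub : connected_stars d g -> connected_stars d f.
Proof.
move=> conn T phi hphi F G Ff Gf TF TG.
have tT : t0 \notin T by apply: contraNN (facet_t0 Ff); apply: (subsetP TF).
suff [T' T'c T'l] : exists2 T' : {set 'I_N},
    (forall K, K \in facets d g -> T' \subset K -> T \subset coarse K) &
    (forall K, K \in facets d f -> T \subset K ->
       exists K', [/\ K' \in facets d g, T' \subset K' & coarse K' = K]).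
  have [F' [F'g TF' <-]] := T'l F Ff TF; have [G' [G'g TG' <-]] := T'l G Gf TG.
  apply: (conn T' (fun K => phi (coarse K))) => // K H Kg Hg TK TH adj.
  by apply: hphi; rewrite ?facet_coarse ?coarse_adjacent ?T'c.
have [ST|ST] := boolP (S \subset T); last first.
  exists T => [K Kg TK|K Kf TK].
    have := coarse_sub TK; by rewrite {1}/coarse (negbTE tT).
  have [SK|SK] := boolP (S \subset K); last first.
    by exists K; rewrite facet_old ?(facet_t0 Kf) // Kf SK /coarse (negbTE (facet_t0 Kf)).
  have [i iS iT] := subsetPn ST.
  exists (t0 |: (K :\ i)); rewrite facet_new // coarse_new //; split => //.
  by apply: subset_trans (subsetUr _ _); rewrite subsetD1 TK.
have [a aS] : exists a, a \in S by apply/set0Pn; rewrite -cards_eq0 -lt0n.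
have tTa : t0 \notin T :\ a by rewrite !inE (negbTE tT) andbF.
exists (t0 |: (T :\ a)) => [K Kg TK|K Kf TK].
  apply: subset_trans (coarse_sub TK); rewrite /coarse setU11 setU1K //.
  apply/subsetP => i iT; rewrite !inE iT andbT.
  by have [->|//] := eqVneq i a; rewrite ?aS ?orbT.
exists (t0 |: (K :\ a)); rewrite facet_new ?(subset_trans ST) //.
by rewrite coarse_new ?(subset_trans ST) // setUS // setSD.
Qed.

(** The facets that replace one facet are pairwise adjacent. *)
Lemma new_adjacent F i j : F \in facets d f -> S \subset F -> i \in S -> j \in S ->
  (d <= #|(t0 |: (F :\ i)) :&: (t0 |: (F :\ j))|.+1)%N.
Proof.
move=> Ff SF iS jS; have tF := facet_t0 Ff.
have -> : (t0 |: (F :\ i)) :&: (t0 |: (F :\ j)) = t0 |: (F :\ i :\ j).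
  apply/setP => k; rewrite !inE.
  by case: (k == t0); case: (k == j); case: (k == i); case: (k \in F).
rewrite cardsU1 !inE (negbTE tF) !andbF add1n.
move: Ff; rewrite inE => /andP[_ /eqP <-].
rewrite (cardsD1 i F) (cardsD1 j (F :\ i)).
by rewrite addnA -[X in (_ <= X)%N]add2n leq_add2r; case: (i \in F); case: (j \in _).
Qed.

(** The map [lift] is a section of [coarse] that always omits the same vertex [i0] of [S], chosen
    outside [T] so that the star of [T] is respected. Every facet is adjacent to the lift of its
    coarse facet, so it suffices that lifts of adjacent facets have equal colours. *)
Lemma connected_stars_sub : connected_stars d f -> connected_stars d g.
Proof.
move=> conn T psi hpsi F0 G0 F0g G0g TF0 TG0.
pose T' := T :\ t0.
have ST' : ~~ (S \subset T').
  apply: contra (facet_not_sub F0g) => /subset_trans; apply.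
  by apply: subset_trans TF0; apply: subD1set.
have [i0 i0S i0T] := subsetPn ST'.
pose lift F := if S \subset F then t0 |: (F :\ i0) else F.
have lift_facet F : F \in facets d f -> lift F \in facets d g.
  move=> Ff; rewrite /lift; case: ifPn => [SF|SF]; first exact: facet_new.
  by rewrite facet_old ?(facet_t0 Ff) ?Ff.
have TT' : T \subset t0 |: T' by apply/subsetP => i; rewrite !inE => ->; case: (i == t0).
have new_sub F i : coarse T \subset F -> i \notin T' -> T \subset t0 |: (F :\ i).
  move=> TF iT; apply: subset_trans TT' _; rewrite setUS // subsetD1 iT andbT.
  apply: subset_trans TF; rewrite /coarse; case: ifP => _; first exact: subsetUr.
  exact: subD1set.
have lift_sub F : coarse T \subset F -> T \subset lift F.
  move=> TF; rewrite /lift; case: ifPn => [SF|SF]; first exact: new_sub.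
  move: TF; rewrite /coarse; case: ifPn => // tT /(subset_trans (subsetUl _ _)).
  by move=> h; rewrite h in SF.
have coarseK F : F \in facets d g -> T \subset F -> psi F = psi (lift (coarse F)).
  move=> Fg TF; have cf := facet_coarse Fg.
  apply: hpsi => //; first exact: lift_facet.
    by apply: lift_sub; apply: coarse_sub.
  have [tF|tF] := boolP (t0 \in F); last first.
    rewrite /lift /coarse (negbTE tF) (negbTE (facet_not_sub Fg)) setIid.
    by move: Fg; rewrite inE => /andP[_ /eqP ->].
  have [i /setDP[iS _] [_ FE]] := facet_apex Fg tF.
  have Sc : S \subset coarse F by rewrite /coarse tF subsetUl.
  by rewrite /lift Sc {1}FE; apply: new_adjacent.
rewrite (coarseK F0) // (coarseK G0) //.
apply: (conn (coarse T) (fun F => psi (lift F))); rewrite ?facet_coarse ?coarse_sub //.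
(* The lift of [F] need not be adjacent to [G]. Omitting instead a vertex of [S] missing from [G]
   gives a facet adjacent to both. *)
have mixed F G : F \in facets d f -> G \in facets d f -> coarse T \subset F ->
  coarse T \subset G -> (d <= #|F :&: G|.+1)%N -> S \subset F -> ~~ (S \subset G) ->
  psi (t0 |: (F :\ i0)) = psi G.
  move=> Ff Gf TF TG adj SF SG; have [i iS iG] := subsetPn SG.
  have tT : t0 \notin T.
    by apply: contra SG => tT; apply: subset_trans TG; rewrite /coarse tT subsetUl.
  have TGE : T \subset G by move: TG; rewrite /coarse (negbTE tT).
  have iT : i \notin T'.
    by apply: contra iG => /setD1P[_]; apply: (subsetP TGE).
  have Gg : G \in facets d g by rewrite facet_old ?(facet_t0 Gf) ?Gf.
  transitivity (psi (t0 |: (F :\ i))); apply: hpsi; rewrite ?facet_new ?new_sub //.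
    exact: new_adjacent.
  apply: leq_trans adj _; rewrite ltnS; apply: subset_leq_card.
  apply/subsetP => j; rewrite !inE => /andP[jF jG]; rewrite jF jG andbT.
  by rewrite (_ : j != i) ?orbT //; apply: contraNneq iG => <-.
move=> F G Ff Gf TF TG adj; have := mixed F G; have := mixed G F.
move: (lift_facet F Ff) (lift_facet G Gf) (lift_sub F TF) (lift_sub G TG).
rewrite /lift; case: ifPn => SF; case: ifPn => SG Fg Gg TF' TG' m1 m2.
- apply: hpsi => //.
  have -> : (t0 |: (F :\ i0)) :&: (t0 |: (G :\ i0)) = t0 |: ((F :&: G) :\ i0).
    by apply/setP => k; rewrite !inE; case: (k == t0); case: (k == i0); case: (k \in F).
  rewrite cardsU1 !inE (negbTE (facet_t0 Ff)) andbF /=.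
  by move: adj; rewrite (cardsD1 i0) inE (subsetP SF) // (subsetP SG).
- exact: m2.
- by rewrite m1 // setIC.
- exact: hpsi.
Qed.

End SubdivisionStars.

Lemma sub_locally_lorentzian (R : realType) (N : nat) (f g : {mpoly R[N]}) d :
  f \is d.-homog -> sub_step f g ->
  g \is d.-homog /\ (locally_lorentzian d f <-> locally_lorentzian d g) /\ g != 0.
Proof.
move=> hf [V [t0 [S [c [[fV tV] SD S0 c0 ->]]]]].
have ft0 : f^`M(t0) = 0 by move/poly_in_mderiv: fV; apply.
have t0S : t0 \notin S.
  apply: contraTN SD => tS; rewrite inE negbK; apply/eqP.
  by apply: (@dpartS0 _ _ [set t0]); rewrite ?sub1set // dpart1.
split; first exact: (homog_sub c t0S hf SD).
split; last first.
  have : set0 \in Delta (subdivision t0 c S f).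
    have t00 : t0 \notin set0 by rewrite inE.
    rewrite (Delta_sub t0S c0 hf ft0 SD t00) (DeltaS (sub0set S) SD).
    by rewrite subset0 -cards_eq0 -lt0n.
  by rewrite inE dpart0.
split=> [[nf hl cs]|[nf hl cs]]; split.
- exact: nonneg_facets_sub.
- exact: hyperbolic_links_sub.
- exact: connected_stars_sub.
- exact: (nonneg_facets_unsub t0S c0).
- exact: (hyperbolic_links_unsub t0S c0).
- exact: (connected_stars_unsub t0S c0).
Qed.

Lemma sub_equiv_locally_lorentzian (R : realType) (N : nat) (f g : {mpoly R[N]}) :
  sub_equiv f g ->
  locally_lorentzian (degree f) f <-> locally_lorentzian (degree g) g.
Proof.
case=> m [F [<- <- sh step]].
have hF k : (k <= m)%N -> F k \is (degree (F k)).-homog.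
  by move/sh => [V []] _ /homog_degreeE.
have main p q : p \is (degree p).-homog -> sub_step p q ->
    locally_lorentzian (degree p) p <-> locally_lorentzian (degree q) q.
  move=> hp /(sub_locally_lorentzian hp)[hq [pq q0]].
  by rewrite (homog_degree hq q0).
elim: m sh step hF => // m ih sh step hF.
apply: iff_trans (ih _ _ _) _ => [k km|k km|k km|].
- by apply: sh; apply: leqW.
- by apply: step; apply: ltnW.
- by apply: hF; apply: leqW.
case: (step m (ltnSn m)) => st; first by apply: main => //; apply: hF.
by apply: iff_sym; apply: main => //; apply: hF.
Qed.

(** * From the local condition to Lorentzian polynomials *)

Section Cones.
Variables (R : realType) (N : nat).
Implicit Types (f g h : {mpoly R[N]}) (V T U F G : {set 'I_N}) (x v w : 'rV[R]_N).
Implicit Types (vs : seq 'rV[R]_N).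

Lemma proj_linear f T l a x y :
  proj f T l (a *: x + y) = a *: proj f T l x + proj f T l y.
Proof.
rewrite /proj; have -> : a *: x + y - \sum_(i in T) (a *: x + y) 0 i *: l i =
   a *: (x - \sum_(i in T) x 0 i *: l i) + (y - \sum_(i in T) y 0 i *: l i).
  have -> : \sum_(i in T) (a *: x + y) 0 i *: l i =
      a *: (\sum_(i in T) x 0 i *: l i) + \sum_(i in T) y 0 i *: l i.
    rewrite scaler_sumr -big_split; apply: eq_bigr => i _ /=.
    by rewrite !mxE scalerDl scalerA.
  by rewrite scalerBr opprD addrACA.
by apply/rowP => i; rewrite !mxE; case: ifP; rewrite ?mulr0 ?addr0.
Qed.

(** Subtracting lineality vectors changes no derivative of [f] and makes the direction vanish on
    [T], where it commutes with [kill T]; the restriction to the link is absorbed by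
    [restrict_linkV]. *)
Lemma proj_Ddirs V f T l vs : proj_family V f T l ->
  Ddirs [seq proj f T l v | v <- vs] (contract f T) = kill T (Ddirs vs (dpart T f)).
Proof.
move=> pf; elim: vs => [//|v vs ih] /=; rewrite ih.
set w := v - \sum_(i in T) v 0 i *: l i.
have wT i : i \in T -> w 0 i = 0.
  move=> iT; rewrite /w !mxE summxE (bigD1 i) //= mxE (pf i iT).2 // eqxx mulr1.
  rewrite big1 ?addr0 ?subrr // => j /andP[jT ji].
  by rewrite mxE (pf j jT).2 // eq_sym (negbTE ji) mulr0.
rewrite kill_Ddir; last by move=> i; apply: restrict_off.
congr (kill T _); rewrite -!Ddirs_Ddir restrict_linkV //; congr (Ddirs vs _).
rewrite /w DdirD -scaleN1r DdirZ.
suff -> : Ddir (\sum_(i in T) v 0 i *: l i) (dpart T f) = 0 by rewrite scaler0 addr0.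
elim/big_rec : _ => [|i y iT iy]; first by rewrite /Ddir big1 // => i _; rewrite mxE scale0r.
rewrite DdirD DdirZ iy addr0 Ddir_mderivm; have [[_ ->] _] := pf i iT.
by rewrite raddf0 scaler0.
Qed.

Lemma exists_proj_family V f T : strongly_hereditary V f -> T \in Delta f ->
  exists e, proj_family V f T e.
Proof.
case=> _ _ her TD.
have /fin_all_exists[e he] : forall i : 'I_N, exists l : 'rV[R]_N, i \in T ->
    lineality V f l /\ forall j, j \in T -> l 0 j = (j == i)%:R.
  by move=> i; have [l lL la] := her T TD (fun j => (j == i)%:R); exists l.
by exists e.
Qed.

Lemma exists_proj V f i : strongly_hereditary V f -> i \in vertices (Delta f) ->
  exists e, proj_family V f [set i] e.
Proof. by move=> sf; rewrite inE; apply: exists_proj_family. Qed.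

Lemma cone_inv V f v : cone V f v -> degree f <> 1%N ->
  exists p l : 'rV[R]_N, [/\ (forall i, i \in V -> 0 < p 0 i), lineality V f l, v = p + l &
    forall i, i \in vertices (Delta f) -> forall e, proj_family V f [set i] e ->
      cone (linkV f [set i]) (contract f [set i]) (proj f [set i] e v)].
Proof.
case=> [{}V {}f {}v -> //|{}V {}f {}v p l _ _ pV lL -> pr] _.
by exists p, l.
Qed.

Lemma vertex_in V f i : strongly_hereditary V f -> i \in vertices (Delta f) -> i \in V.
Proof.
case=> /poly_in_mderiv fV _ _; rewrite Delta_mderiv; apply: contraNT => iV.
by rewrite fV.
Qed.

Lemma vertex_Delta f i : i \in vertices (Delta f) -> [set i] \in Delta f.
Proof. by rewrite inE. Qed.

Lemma contract_neq0 f T V d : strongly_hereditary V f -> f \is d.-homog ->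
  T \in Delta f -> contract f T != 0.
Proof.
by move=> sf hf TD; rewrite contractE (dpart_kill_neq0 sf hf) //; move: TD; rewrite inE.
Qed.

Lemma Ddir_coef v h : (Ddir v h)@_0%MM = \sum_i v 0 i * (h^`M(i))@_0%MM.
Proof. by rewrite /Ddir mcoeff_sum; apply: eq_bigr => i _; rewrite mcoeffZ. Qed.

Lemma Ddirs_proj_coef V f i e vs : proj_family V f [set i] e ->
  (Ddirs [seq proj f [set i] e v | v <- vs] (contract f [set i]))@_0%MM =
  (Ddirs vs f^`M(i))@_0%MM.
Proof. by move=> pe; rewrite (proj_Ddirs _ pe) kill_coef0 dpart1. Qed.

Lemma cone_pos d V f vs : strongly_hereditary V f -> f \is d.-homog -> f != 0 ->
  nonneg_facets d f -> size vs = d -> {in vs, forall v, cone V f v} ->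
  0 < (Ddirs vs f)@_0%MM.
Proof.
elim: d V f vs => [|d ih] V f vs sf hf f0 pos.
  move/size0nil => -> _ /=; have := pos set0 (cards0 _); rewrite dpart0 le_eqVlt.
  case/predU1P => // h; case/eqP: f0.
  by rewrite (homog0C hf) -h mpolyC0.
case: vs => // v vs [sz] vK.
have hv : cone V f v by apply: vK; rewrite inE eqxx.
have df := homog_degree hf f0.
have [d0|d0] := posnP d.
  rewrite d0 in sz df hf; rewrite (size0nil sz) /= -meval_homog1 //.
  by case: hv df => // {}V {}f {}v p l.
have [|p [l [pV [_ lL] vE _]]] := cone_inv hv; first by rewrite df => -[] /eqP; rewrite gtn_eqF.
rewrite /= -Ddirs_Ddir vE DdirD lL addr0 Ddirs_Ddir Ddir_coef.
have pos_i i : i \in vertices (Delta f) -> 0 < p 0 i * ((Ddirs vs f)^`M(i))@_0%MM.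
  move=> iX; rewrite mulr_gt0 ?pV ?(vertex_in sf) // -Ddirs_mderiv.
  have iD := vertex_Delta iX; have [e pe] := exists_proj sf iX.
  rewrite -(Ddirs_proj_coef _ pe).
  apply: (ih (linkV f [set i])); first exact: sh_contract sf hf _ iD.
  - by have := homog_contract [set i] hf; rewrite cards1 subn1.
  - exact: contract_neq0 sf hf iD.
  - by have := nonneg_facets_contract hf pos iD; rewrite cards1 subn1.
  - by rewrite size_map.
  move=> _ /mapP[w wvs ->].
  have wK : cone V f w by apply: vK; rewrite inE wvs orbT.
  have [|p' [l' [_ _ _]]] := cone_inv wK; last by apply.
  by rewrite df => -[] /eqP; rewrite gtn_eqF.
have [i fi] := homog_mderiv_neq0 hf f0.
rewrite (bigD1 i) //= ltr_pwDl ?pos_i ?Delta_mderiv //.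
apply: sumr_ge0 => j _; have [/pos_i/ltW //|] := boolP (j \in vertices (Delta f)).
by rewrite Delta_mderiv negbK => /eqP fj; rewrite -Ddirs_mderiv fj Ddirs0 mcoeff0 mulr0.
Qed.

Lemma cone_proj d V f i e : f \is d.+2.-homog -> f != 0 ->
  i \in vertices (Delta f) -> proj_family V f [set i] e ->
  forall v, cone V f v ->
  cone (linkV f [set i]) (contract f [set i]) (proj f [set i] e v).
Proof.
move=> hf f0 iX pe v vK; have [|p [l [_ _ _]]] := cone_inv vK; last by apply.
by rewrite (homog_degree hf f0).
Qed.

Lemma vertex_pos d V f i vs : strongly_hereditary V f -> f \is d.+2.-homog ->
  nonneg_facets d.+2 f -> i \in vertices (Delta f) -> size vs = d.+1 ->
  {in vs, forall v, cone V f v} -> 0 < (Ddirs vs f^`M(i))@_0%MM.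
Proof.
move=> sf hf pos iX sz vK; have iD := vertex_Delta iX.
have f0 : f != 0 by apply: contraTneq iX => ->; rewrite Delta_mderiv raddf0 eqxx.
have [e pe] := exists_proj sf iX; rewrite -(Ddirs_proj_coef _ pe).
apply: (@cone_pos d.+1 (linkV f [set i])); first exact: sh_contract sf hf _ iD.
- by have := homog_contract [set i] hf; rewrite cards1 subn1.
- exact: contract_neq0 sf hf iD.
- by have := nonneg_facets_contract hf pos iD; rewrite cards1 subn1.
- by rewrite size_map.
by move=> _ /mapP[w wvs ->]; apply: (cone_proj hf f0 iX pe); apply: vK.
Qed.

(** Contracting [i] turns the edge into a vertex [j] of the link, to which [vertex_pos] applies.
    These are the strictly positive off-diagonal entries of the Hessian, hence the edges of its
    graph. *)
Lemma edge_pos d V f i j vs : strongly_hereditary V f -> f \is d.+3.-homog ->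
  nonneg_facets d.+3 f -> i != j -> [set i; j] \in Delta f -> size vs = d.+1 ->
  {in vs, forall v, cone V f v} -> 0 < (Ddirs vs f^`M(i)^`M(j))@_0%MM.
Proof.
move=> sf hf pos ij ijD sz vK.
have iX : i \in vertices (Delta f) by rewrite inE (DeltaS _ ijD) // subsetUl.
have iD := vertex_Delta iX.
have f0 : f != 0 by apply: contraTneq iX => ->; rewrite Delta_mderiv raddf0 eqxx.
have [e pe] := exists_proj sf iX.
have jX : j \in vertices (Delta (contract f [set i])).
  rewrite (vertices_linkV sf hf iD) in_linkV inE eq_sym ij /=.
  by rewrite setUC.
have -> : (Ddirs vs f^`M(i)^`M(j))@_0%MM =
  (Ddirs [seq proj f [set i] e v | v <- vs] (contract f [set i])^`M(j))@_0%MM.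
  rewrite !Ddirs_mderiv (proj_Ddirs _ pe) kill_mderiv; last by rewrite inE eq_sym.
  by rewrite kill_coef0 dpart1 Ddirs_mderiv.
apply: (@vertex_pos d (linkV f [set i])) => //; first exact: sh_contract sf hf _ iD.
- by have := homog_contract [set i] hf; rewrite cards1 subn1.
- by have := nonneg_facets_contract hf pos iD; rewrite cards1 subn1.
- by rewrite size_map.
by move=> _ /mapP[w wvs ->]; apply: (cone_proj hf f0 iX pe); apply: vK.
Qed.

Lemma form_mx_Ddirs vs f i j : (form_mx (Ddirs vs f)) i j = (Ddirs vs f^`M(i)^`M(j))@_0%MM.
Proof. by rewrite mxE !Ddirs_mderiv. Qed.

(* The facets of a connected complex of dimension at least 1 are linked by
   ridges, hence by common vertices. *)
Lemma connected_vertices d V f (a : 'I_N -> R) : strongly_hereditary V f ->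
  f \is d.+2.-homog -> connected_stars d.+2 f ->
  (forall i j, i != j -> [set i; j] \in Delta f -> a i = a j) ->
  {in vertices (Delta f) &, forall i j, a i = a j}.
Proof.
move=> sf hf conn ha i j iX jX.
have [F [iF FD Fd]] := Delta_facet sf hf (vertex_Delta iX).
have [G [jG GD Gd]] := Delta_facet sf hf (vertex_Delta jX).
rewrite sub1set in iF; rewrite sub1set in jG.
have cst K : K \in Delta f -> {in K &, forall k k', a k = a k'}.
  move=> KD k k' kK k'K; have [->//|kk'] := eqVneq k k'.
  by apply: ha => //; apply: DeltaS KD; rewrite subUset !sub1set kK.
(* Any two vertices of a face span an edge, so [a] is constant on each facet; the colour records
   whether that constant is [a i]. *)
pose phi (K : {set 'I_N}) := [forall k in K, a k == a i].
have phiE K k : K \in Delta f -> k \in K -> phi K = (a k == a i).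
  move=> KD kK; apply/forall_inP/eqP => [/(_ k kK)/eqP //|<- k' k'K].
  by apply/eqP/(cst K KD).
have : phi F = phi G.
  apply: (conn set0 phi); rewrite ?sub0set //.
  - move=> K H /setIdP[KD _] /setIdP[HD _] _ _ adj.
    have : (0 < #|K :&: H|)%N by apply: leq_trans (ltn0Sn d) _.
    rewrite card_gt0 => /set0Pn[k /setIP[kK kH]].
    by rewrite (phiE K k) // (phiE H k).
  - by apply/setIdP; rewrite FD Fd.
  - by apply/setIdP; rewrite GD Gd.
by rewrite (phiE F i) // (phiE G j) // eqxx => /esym/eqP.
Qed.

Lemma cone_hyperbolic vs V f :
  strongly_hereditary V f -> f \is (size vs).+2.-homog ->
  locally_lorentzian (size vs).+2 f -> {in vs, forall v, cone V f v} ->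
  hyperbolic (fun x => bil (form_mx (Ddirs vs f)) x x).
Proof.
have [n] := ubnP (size vs); elim: n vs V f => // n ih [|v vs] V f sz sf hf lf vK.
  have [_ hl _] := lf; have := hl set0; rewrite cards0 => /(_ erefl).
  move/(hyperbolicZ (ler0n R 2)); apply: eq_hyperbolic => x.
  by rewrite dpart0 meval_homog2 // mulrA divff ?mul1r // pnatr_eq0.
have [pos _ conn] := lf.
have [f0|f0] := eqVneq f 0.
  apply: eq_hyperbolic (hyperbolic0 R N) => x; rewrite bil_form f0 /= -!Ddirs_Ddir.
  by rewrite !raddf0 Ddirs0 mcoeff0.
pose X := vertices (Delta f).
have vK0 : cone V f v by apply: vK; rewrite inE eqxx.
have vsK w : w \in vs -> cone V f w by move=> wvs; apply: vK; rewrite inE wvs orbT.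
have [|p [l [pV [_ lL] vE _]]] := cone_inv vK0; first by rewrite (homog_degree hf f0).
(* [V] may contain variables that do not occur in [f]; there the rows of the Hessian vanish and [p]
   has to be cut to 0. *)
pose p' : 'rV[R]_N := \row_i (if i \in X then p 0 i else 0).
have Xf i : i \notin X -> f^`M(i) = 0 by rewrite Delta_mderiv negbK => /eqP.
have p'f h : (forall i, i \notin X -> h^`M(i) = 0) -> Ddir l h = 0 -> Ddir p' h = Ddir v h.
  move=> hX lh; rewrite vE DdirD lh addr0; apply: eq_Ddir => i hi; rewrite mxE.
  by case: ifPn => // /hX h0; rewrite h0 eqxx in hi.
have rowv x i : (x *m form_mx (Ddirs (v :: vs) f)) 0 i =
    (Ddirs (v :: x :: vs) f^`M(i))@_0%MM.
  by rewrite form_row /= Ddir_comm -!Ddir_mderiv Ddirs_mderiv.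
have rowp i : (p' *m form_mx (Ddirs (v :: vs) f)) 0 i =
    (Ddirs (v :: v :: vs) f^`M(i))@_0%MM.
  rewrite rowv /= -!Ddirs_Ddir p'f // => [j jX|].
    by rewrite mderiv_comm Xf // raddf0.
  by rewrite Ddir_mderiv lL raddf0.
have vpos i : i \in X -> 0 < (Ddirs (v :: v :: vs) f^`M(i))@_0%MM.
  move=> iX; apply: (vertex_pos sf hf pos) => //= w.
  by rewrite !inE => /or3P[/eqP->|/eqP->|/vsK].
have edge i j : i != j -> [set i; j] \in Delta f ->
    0 < form_mx (Ddirs (v :: vs) f) i j.
  by move=> ij ijD; rewrite form_mx_Ddirs; apply: (edge_pos sf hf pos).
apply: (@trickling_down R N _ X p').
- exact: form_mx_sym.
- by move=> i j /Xf fi; rewrite form_mx_Ddirs fi raddf0 Ddirs0 mcoeff0.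
- move=> i j ij; have [/(edge i j ij)/ltW //|] := boolP ([set i; j] \in Delta f).
  move/notin_Delta; rewrite dpartU1 ?inE // dpart1 mderiv_comm form_mx_Ddirs => ->.
  by rewrite Ddirs0 mcoeff0.
- move=> a ha; apply: (connected_vertices sf hf conn) => i j ij ijD.
  by apply: ha => //; apply: edge.
- by move=> i iX; rewrite mxE iX pV // (vertex_in sf).
- by move=> i iX; rewrite mxE (negbTE iX).
- by move=> i iX; rewrite rowp vpos.
move=> x.
(* The Hessian as the sum of p_i times the Hessians of the partial derivatives, since [v] acts on
   [f] as [p']. *)
have -> : bil (form_mx (Ddirs (v :: vs) f)) x x =
    \sum_(i in X) p' 0 i * bil (form_mx (Ddirs vs f^`M(i))) x x.
  rewrite bil_form /= 2!(Ddir_comm x v) -[in LHS]p'f.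
  - rewrite Ddir_coef [RHS]big_mkcond; apply: eq_bigr => i _ /=; rewrite mxE.
    by case: ifP => _; rewrite ?mul0r // bil_form !Ddirs_mderiv !Ddir_mderiv.
  - by move=> i iX; rewrite -!Ddir_mderiv -Ddirs_mderiv Xf // Ddirs0 !raddf0.
  - by rewrite -!Ddirs_Ddir !(Ddir_comm l) lL !raddf0 Ddirs0.
apply: ler_sum => i iX.
rewrite -mulrA ler_wpM2l //; first by rewrite mxE iX ltW // pV // (vertex_in sf).
rewrite ler_pdivlMr ?rowp ?vpos // rowv mulrC.
have iD := vertex_Delta iX; have [e pe] := exists_proj sf iX.
pose vs' := [seq proj f [set i] e w | w <- vs].
have Gh : hyperbolic (fun x => bil (form_mx (Ddirs vs f^`M(i))) x x).
  have hi : hyperbolic (fun x => bil (form_mx (Ddirs vs' (contract f [set i]))) x x).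
    have dE : (size vs').+2 = (size (v :: vs)).+2.-1 by rewrite size_map.
    apply: (ih vs' (linkV f [set i])); first by rewrite size_map.
    - exact: sh_contract sf hf _ iD.
    - by have := homog_contract [set i] hf; rewrite dE cards1 subn1.
    - by have := locally_lorentzian_contract sf hf lf iD; rewrite dE cards1 subn1.
    by move=> _ /mapP[w wvs ->]; apply: (cone_proj hf f0 iX pe); apply: vsK.
  have := hyperbolic_comp (proj_linear f [set i] e) hi; apply: eq_hyperbolic => y.
  rewrite !bil_form; have := Ddirs_proj_coef [:: y, y & vs] pe.
  by move=> /= <-.
have bv w y : bil (form_mx (Ddirs vs f^`M(i))) w y = (Ddirs [:: w, y & vs] f^`M(i))@_0%MM.
  by rewrite bil_form.
(* Pairing with [v] in the form of the i-th derivative gives the i-th entry of [x] times the full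
   Hessian, so this is the i-th summand of the required inequality. *)
have := hyperbolic_CS x (form_mx_sym _) Gh (_ : 0 < bil _ v v).
by rewrite bv vpos // => /(_ erefl); rewrite [X in _ <= X ^+ 2]bv.
Qed.

(** At most one positive eigenvalue comes from [cone_hyperbolic], at least one from positivity of
    the form at a direction of the cone. *)
Lemma cone_lorentzian V f : strongly_hereditary V f ->
  locally_lorentzian (degree f) f -> f != 0 -> lorentzian (cone V f) f.
Proof.
move=> sf lf f0; have hf := homog_degreeE (let: And3 _ h _ := sf in h).
have [pos _ _] := lf; split=> // [d0|d0 vs vK].
  by have := pos set0; rewrite cards0 dpart0; apply.
have vK' : {in vs, forall v, cone V f v} by move=> v /tnthP[i ->].
split.
  apply/pos_constE; last exact: cone_pos sf hf f0 pos (size_tuple vs) vK'.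
  by have := homog_Ddirs vs hf; rewrite size_tuple subnn.
move=> d1; have sz : (size (drop 2 vs)).+2 = degree f.
  by rewrite size_drop size_tuple; move: d1; case: (degree f) => [|[|n]] //= _; rewrite subn2.
have vi : tnth vs (Ordinal d0) \in vs by apply: mem_tnth.
have dK : {in drop 2 vs, forall v, cone V f v} by move=> v /mem_drop; apply: vK'.
apply: (@hyperbolic_one_pos _ _ _ (tnth vs (Ordinal d0))); first exact: form_mx_sym.
  by apply: cone_hyperbolic sf _ _ dK; rewrite sz.
rewrite bil_form.
apply: (@cone_pos _ V f [:: tnth vs (Ordinal d0), tnth vs (Ordinal d0) & drop 2 vs] sf hf f0 pos).
  by rewrite /= sz.
by move=> v; rewrite !inE => /or3P[/eqP->|/eqP->|/dK //]; apply: vK'.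
Qed.

Lemma locally_lorentzian_hereditary V f : strongly_hereditary V f ->
  locally_lorentzian (degree f) f -> hereditary_lorentzian f.
Proof.
move=> sf lf T; rewrite inE => /andP[TD _].
have hf := homog_degreeE (let: And3 _ h _ := sf in h).
have cf0 := contract_neq0 sf hf TD.
apply: cone_lorentzian => //; first exact: sh_contract sf hf _ TD.
rewrite (homog_degree (homog_contract T hf) cf0).
exact: locally_lorentzian_contract sf hf lf TD.
Qed.

End Cones.

(** * From Lorentzian polynomials to the local condition *)

Section Converse.
Variables (R : realType) (N : nat).
Implicit Types (f g h : {mpoly R[N]}) (V W T U F G K : {set 'I_N}) (x v w : 'rV[R]_N).

Lemma positive_nonneg_facets d f : f \is d.-homog -> positive f -> nonneg_facets d f.
Proof.
move=> hf pos F Fd; have [FD|/notin_Delta ->] := boolP (F \in Delta f); last first.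
  by rewrite mcoeff0.
have [|a a0 ->] := pos F; last by rewrite mcoeffC eqxx mulr1 ltW.
apply/maxsetP; split=> // G GD FG; apply/esym/eqP.
by rewrite eqEcard FG Fd (card_Delta hf GD).
Qed.

Lemma tau_Delta V f d T : strongly_hereditary V f -> f \is d.-homog ->
  T \in Delta f -> (#|T| < d)%N -> T \in tau (Delta f).
Proof.
move=> sf hf TD Td; rewrite inE TD /=; have [j jT jTD] := Delta_grow sf hf TD Td.
apply/negP => /maxsetP[_ /(_ _ jTD (subsetU1 _ _)) jE].
by rewrite -jE setU11 in jT.
Qed.

Lemma proj_family_sub V W f T e : W \subset V ->
  proj_family W f T e -> proj_family V f T e.
Proof.
move=> WV pe i iT; have [[vl l0] li] := pe i iT; split=> //; split=> // j jV.
by apply: vl; apply: contraNN jV; apply: (subsetP WV).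
Qed.

Lemma restrict_vertices f v :
  Ddir (restrict (vertices (Delta f)) v) f = Ddir v f.
Proof. by apply: eq_Ddir => i fi; rewrite mxE Delta_mderiv fi. Qed.

(** Contraction at the empty face leaves [f] unchanged but replaces [V] by the set of vertices, so
    the two cones live in different spaces. *)
Lemma cone_restrict V f v : strongly_hereditary V f -> cone V f v ->
  cone (vertices (Delta f)) f (restrict (vertices (Delta f)) v).
Proof.
have rX X w : vec_in X (restrict X w) by move=> i iX; rewrite mxE (negbTE iX).
move=> sf vK; case: vK sf => {}V {}f {}v => [df vV fv|p l df pV pp [lV fl] -> pr] sf.
  have hf := homog_degreeE (let: And3 _ h _ := sf in h); rewrite df in hf.
  by apply: cone_linear => //; move: fv; rewrite !meval_homog1 // restrict_vertices.
pose X := vertices (Delta f).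
have XV : X \subset V by apply/subsetP => i; apply: (vertex_in sf).
apply: (@cone_rec _ _ _ _ _ (restrict X p) (restrict X l)) => //.
- by move=> i iX; rewrite mxE iX pp // (subsetP XV).
- by split=> //; rewrite restrict_vertices.
- by apply/rowP => i; rewrite !mxE; case: ifP => //; rewrite addr0.
move=> i iX e pe; have := pr i iX e (proj_family_sub XV pe).
congr (cone _ _ _); apply/rowP => k; rewrite !mxE; case: ifP => // kL.
have kX : k \in X.
  rewrite inE; move: kL; rewrite in_linkV => /andP[_]; apply: DeltaS.
  exact: subsetUl.
by rewrite !summxE kX; congr (_ - _); rewrite !big_set1 !mxE iX.
Qed.

(** By the recursion defining the cone, each projection along a vertex lands in the cone of the
    contraction; a point is pushed to the link of [T] one vertex at a time. *)
Lemma link_cone_nonempty V f T : strongly_hereditary V f ->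
  (exists v, cone V f v) -> T \in Delta f -> (#|T| < degree f)%N ->
  exists v, cone (linkV f T) (contract f T) v.
Proof.
move=> sf [v vK]; have hf := homog_degreeE (let: And3 _ h _ := sf in h).
have [n le_n] := ubnP #|T|; elim: n T le_n => // n ih T le_n TD Td.
have [T0|[i iT]] := set_0Vmem T.
  have s0 : set0 \in Delta f by rewrite -T0.
  exists (restrict (vertices (Delta f)) v); rewrite T0 -(vertices_linkV sf hf) //.
  by rewrite contractE kill0E dpart0; apply: cone_restrict sf vK.
pose U := T :\ i; have iU : i \notin U by rewrite setD11.
have TE : T = [set i] :|: U by rewrite setD1K.
have cT : #|T| = #|U|.+1 by rewrite TE cardsU1 iU.
have UD : U \in Delta f by apply: DeltaS TD; apply: subD1set.
have [||w wK] := ih U _ UD; [by rewrite -ltnS -cT|by apply: ltn_trans Td; rewrite cT|].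
have sU := sh_contract sf hf UD; have hU := homog_contract U hf.
have iX : i \in vertices (Delta (contract f U)).
  by rewrite (vertices_linkV sf hf UD) in_linkV iU -TE.
have [e pe] := exists_proj sU iX.
have [|p [l [_ _ _ pr]]] := cone_inv wK.
  rewrite (homog_degree hU (contract_neq0 sf hf UD)) => d1.
  by move: Td; rewrite cT -(subnK (card_Delta hf UD)) d1 add1n ltnn.
have dis : [disjoint [set i] & U] by rewrite disjoints1.
exists (proj (contract f U) [set i] e w); have := pr i iX e pe.
rewrite -(vertices_linkV sU hU (vertex_Delta iX)) contract_contract // -TE.
by rewrite (vertices_linkV sf hf TD).
Qed.

Lemma drop_nseq n k (v : 'rV[R]_N) : drop n (nseq k v) = nseq (k - n) v.
Proof. by elim: n k => [|n ih] [|k] //=; rewrite ih. Qed.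

Lemma lorentzian_hyperbolic V h v k : cone V h v -> lorentzian (cone V h) h ->
  degree h = k.+2 -> hyperbolic (fun x => bil (form_mx (Ddirs (nseq k v) h)) x x).
Proof.
move=> vK [_ _ lh] hk; apply: one_pos_hyperbolic; first exact: form_mx_sym.
have [||_] := lh _ [tuple of nseq (degree h) v]; first by rewrite hk.
  by move=> i; rewrite (tnth_nth v) /= nth_nseq if_same.
by rewrite hk drop_nseq subn2 /=; apply.
Qed.

(* Two components of the graph of [h] would carry two orthogonal positive
   vectors. *)
Lemma lorentzian_connected V h v k (b : 'I_N -> bool) :
  strongly_hereditary V h -> h \is k.+2.-homog -> h != 0 -> nonneg_facets k.+2 h ->
  cone V h v -> lorentzian (cone V h) h ->
  (forall i j, i != j -> [set i; j] \in Delta h -> b i = b j) ->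
  {in vertices (Delta h) &, forall i j, b i = b j}.
Proof.
move=> sh hh h0 pos vK lh hb.
have dh := homog_degree hh h0.
pose H := form_mx (Ddirs (nseq k v) h); pose X := vertices (Delta h).
have hypH : hyperbolic (fun x => bil H x x) by apply: lorentzian_hyperbolic vK lh dh.
have [|p [l [pV [_ lh0] vE _]]] := cone_inv vK; first by rewrite dh.
have sH : H^T = H by apply: form_mx_sym.
have vH i : i \in X -> 0 < (v *m H) 0 i.
  move=> iX; rewrite form_row -Ddirs_mderiv.
  apply: (@vertex_pos _ _ k V h i (v :: nseq k v)) => //=; first by rewrite size_nseq.
  by move=> w; rewrite inE => /orP[/eqP->|/nseqP[->]].
(* The positive vector [p] cut to the vertices of one colour; no edge joins the two colours, so the
   two parts are orthogonal for [H]. *)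
pose part (c : bool) : 'rV[R]_N := \row_i (if (i \in X) && (b i == c) then p 0 i else 0).
have p0 i : i \in X -> 0 < p 0 i by move=> iX; rewrite pV // (vertex_in sh).
have partX c : bil H (part c) (part (~~ c)) = 0.
  rewrite bilEE big1 // => i _; rewrite big1 // => j _; rewrite !mxE.
  case: ifP; last by rewrite !mul0r.
  case: ifP; last by rewrite mulr0.
  move=> /andP[_ /eqP bi] /andP[_ /eqP bj].
  have ji : j != i.
    apply: contraNneq (_ : ~~ (c == ~~ c)) => [e|]; first by rewrite -bi -bj e.
    by case: c bi bj.
  rewrite -Ddirs_mderiv -Ddirs_mderiv.
  have -> : h^`M(j)^`M(i) = 0.
    have [/(hb j i ji)|/notin_Delta] := boolP ([set j; i] \in Delta h).
      by rewrite bi bj; case: c bi bj.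
    by rewrite dpartU1 ?inE // dpart1 mderiv_comm.
  by rewrite Ddirs0 mcoeff0 mulr0 mul0r.
have part_sum c : part c + part (~~ c) = \row_i (if i \in X then p 0 i else 0).
  apply/rowP => i; rewrite !mxE; case: (i \in X); rewrite ?addr0 //=.
  by case: (b i); case: c; rewrite ?addr0 ?add0r.
(* The cross term being 0, one argument may be completed to all of [p], which acts on the
   derivatives of [h] as [v] does. *)
have partH c : bil H (part c) (part c) = \sum_i (v *m H) 0 i * part c 0 i.
  have -> : bil H (part c) (part c) = bil H (part c + part (~~ c)) (part c).
    by rewrite bilDl [X in _ = _ + X]bilC // partX addr0.
  rewrite bilE; apply: eq_bigr => i _; congr (_ * _).
  rewrite part_sum !form_row; congr (_@_0%MM).
  rewrite -Ddirs_mderiv -!Ddirs_Ddir.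
  have -> : Ddir v h^`M(i) = Ddir p h^`M(i).
    by rewrite vE DdirD [X in _ + X]Ddir_mderiv lh0 raddf0 addr0.
  congr (Ddirs _ _); apply: eq_Ddir => j hj; rewrite mxE ifT //.
  rewrite Delta_mderiv; apply: contraNneq hj => e.
  by rewrite mderiv_comm e raddf0.
have part_pos i c : i \in X -> b i = c -> 0 < bil H (part c) (part c).
  move=> iX bi; rewrite partH (bigD1 i) //= ltr_pwDl //.
    by rewrite mulr_gt0 ?vH // [part c 0 i]mxE iX bi eqxx p0.
  apply: sumr_ge0 => j _; rewrite [part c 0 j]mxE.
  case: ifP => [/andP[jX _]|]; last by rewrite mulr0.
  by rewrite mulr_ge0 // ltW ?vH ?p0.
move=> i j iX jX; apply/eqP; apply: contraT => bij.
have bj : b j = ~~ b i by move: bij; case: (b i); case: (b j).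
have := hyperbolic_orth sH hypH (part_pos i _ iX erefl) (partX _).
by rewrite leNgt (part_pos j).
Qed.

Lemma hereditary_locally_lorentzian V f : strongly_hereditary V f ->
  positive f -> (exists v, cone V f v) -> hereditary_lorentzian f ->
  locally_lorentzian (degree f) f.
Proof.
move=> sf pf Kf HL; have hf := homog_degreeE (let: And3 _ h _ := sf in h).
set d := degree f in hf *.
have pos := positive_nonneg_facets hf pf.
have linkK T k : T \in Delta f -> (#|T| + k.+1 = d)%N ->
  [/\ strongly_hereditary (linkV f T) (contract f T), contract f T \is k.+1.-homog,
     degree (contract f T) = k.+1, nonneg_facets k.+1 (contract f T) &
     (exists v, cone (linkV f T) (contract f T) v) /\
     lorentzian (cone (linkV f T) (contract f T)) (contract f T)].
  move=> TD Tk; have kE : (d - #|T|)%N = k.+1 by rewrite -Tk addKn.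
  have Td : (#|T| < d)%N by rewrite -Tk addnS ltnS leq_addr.
  have hT := homog_contract T hf; rewrite kE in hT.
  split=> //; first exact: sh_contract sf hf _ TD.
  - by rewrite (homog_degree hT) ?(contract_neq0 sf hf TD).
  - by have := nonneg_facets_contract hf pos TD; rewrite kE.
  split; first exact: link_cone_nonempty sf Kf TD Td.
  by apply: HL; apply: tau_Delta sf hf TD Td.
split=> //.
- move=> T Td; have [TD|/notin_Delta T0] := boolP (T \in Delta f); last first.
    by apply: eq_hyperbolic (hyperbolic0 R N) => x; rewrite T0 meval0.
  have [|sT hT dT _ [[v vK] lT]] := linkK T 1%N TD; first by rewrite addn2.
  have := lorentzian_hyperbolic vK lT dT => /= hyp.
  have [e pe] := exists_proj_family sf TD.
  have := hyperbolicZ (_ : 0 <= 2^-1) (hyperbolic_comp (proj_linear f T e) hyp).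
  rewrite invr_ge0 ler0n => /(_ isT); apply: eq_hyperbolic => x.
  have h2 : dpart T f \is 2.-homog by have := homog_dpart T hf; rewrite -Td -addn2 addKn.
  rewrite (meval_homog2 _ h2) !bil_form; congr (_ * _).
  have := congr1 (mcoeff 0%MM) (proj_Ddirs [:: x; x] pe).
  by rewrite kill_coef0.
(* Induction from large [T] to small: the stars of the faces i |: T are settled, and the link of [T]
   has a connected graph by [lorentzian_connected]. *)
move=> T phi; have [n le_n] := ubnP (d - #|T|)%N.
elim: n T le_n => // n ih T le_n hphi F G Ff Gf TF TG.
have Fd : #|F| = d by move: Ff => /setIdP[_ /eqP].
have Gd : #|G| = d by move: Gf => /setIdP[_ /eqP].
(* When [T] has at least d - 1 elements, any two facets through it are already adjacent. *)
have [dT|Td] := leqP d #|T|.+1.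
  apply: hphi => //; apply: leq_trans dT _; rewrite ltnS; apply: subset_leq_card.
  by rewrite subsetI TF.
have FD : F \in Delta f by move: Ff => /setIdP[].
have GD : G \in Delta f by move: Gf => /setIdP[].
have TD : T \in Delta f := DeltaS TF FD.
(* By induction all facets through i |: T share a colour; [b] makes it a colouring of the vertices
   of the link, constant along edges since an edge extends to a facet. *)
pose b i := [exists K in facets d f, (i |: T \subset K) && phi K].
have bE i K : i \notin T -> K \in facets d f -> i |: T \subset K -> b i = phi K.
  move=> iT Kd iTK; apply/idP/idP; last first.
    by move=> pK; apply/exists_inP; exists K; rewrite ?iTK.
  case/exists_inP => K' K'f /andP[iTK']; rewrite (ih (i |: T) _ _ K' K) //.
    have : (0 < d - #|T|)%N by rewrite subn_gt0 ltnW.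
    by rewrite cardsU1 iT add1n subnS; move: le_n; case: (d - #|T|)%N.
  move=> A B Af Bf; rewrite !subUset => /andP[_ TA] /andP[_ TB].
  exact: hphi.
have [|sT hT dT posT [[v vK] lT]] := linkK T (d - #|T|).-2.+1 TD.
  have := subnKC (ltnW (ltnW Td)); case: (d - #|T|)%N => [|[|m]] //.
    by rewrite addn0 => Te; move: Td; rewrite Te ltnNge leqnSn.
  by rewrite addn1 => Te; move: Td; rewrite -Te ltnn.
have X0 : contract f T != 0 := contract_neq0 sf hf TD.
have pick H : H \in Delta f -> H \in facets d f -> #|H| = d -> T \subset H ->
    exists i, [/\ i \notin T, i \in vertices (Delta (contract f T)) & b i = phi H].
  move=> HD Hf Hd TH; have : ~~ (H \subset T).
    by apply: contraL Td => /subset_leq_card; rewrite Hd -leqNgt => /leq_trans; apply; rewrite leqW.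
  case/subsetPn => i iH iT; exists i; split=> //.
    rewrite (vertices_linkV sf hf TD) in_linkV iT /=; apply: DeltaS HD.
    by rewrite subUset sub1set iH.
  by apply: bE; rewrite // subUset sub1set iH.
have [i [iT iX <-]] := pick F FD Ff Fd TF; have [j [jT jX <-]] := pick G GD Gf Gd TG.
apply: (lorentzian_connected sT hT X0 posT vK lT) => // i' j' ij.
rewrite (Delta_contract sf hf TD) inE powersetE => /andP[ijT ijTD].
have [K [ijK KD Kd]] := Delta_facet sf hf ijTD.
have Kfac : K \in facets d f by apply/setIdP; rewrite KD Kd.
move: ijT ijK; rewrite !subUset !sub1set !inE => /andP[i'T j'T] /andP[/andP[i'K j'K] TK].
by rewrite (bE i' K) ?(bE j' K) // subUset sub1set ?i'K ?j'K.
Qed.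

End Converse.

Theorem theorem5p8 (R : realType) (N : nat) (V W : {set 'I_N})
    (f g : {mpoly R[N]})
    (hf : strongly_hereditary V f) (hg : strongly_hereditary W g)
    (pf : positive f) (pg : positive g)
    (fg : sub_equiv f g)
    (Kf : exists v, cone V f v) (Kg : exists v, cone W g v) :
  hereditary_lorentzian f <-> hereditary_lorentzian g.
Proof.
have e := sub_equiv_locally_lorentzian fg; split=> HL.
  apply: (locally_lorentzian_hereditary hg); apply/e.
  exact: hereditary_locally_lorentzian hf pf Kf HL.
apply: (locally_lorentzian_hereditary hf); apply/e.
exact: hereditary_locally_lorentzian hg pg Kg HL.
Qed.
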